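(* Let $K$ be a field with $\mathrm{char}(K)\neq 2$ and let $X=\{x_1,x_2,\ldots\}$ be a finite or countable set with more than one element. The following polynomials of $K\langle X\rangle$ (where all indices refer to elements of $X$) form a minimal Gröbner basis, with respect to the deg-lex ordering, of the T-ideal of $K\langle X\rangle$ generated by $[x_1,x_2,x_3]$: \[ f'_{ij}=[[x_i,x_j],x_j],\quad f''_{ij}=[x_i,[x_i,x_j]],\quad i>j, \] \[ g'_{ijk}=[x_i,[x_j,x_k]],\quad g''_{ikj}=[[x_i,x_k],x_j],\quad i>j>k, \] \[ t_{ij}=[x_i,x_j][x_i,x_j],\quad i>j, \] \[ u'_{ijk}=[x_i,x_j][x_i,x_k],\quad u''_{ijk}=[x_i,x_k][x_i,x_j],\quad i>j>k, \] \[ v'_{ijka}=[x_j,x_k]x_j^{a_j}\cdots x_{i-1}^{a_{i-1}}[x_i,x_k],\quad v''_{ijka}=[x_j,x_k]x_j^{a_j}\cdots x_{i-1}^{a_{i-1}}[x_i,x_j], \] where $i>j>k$ and $a_j,\ldots,a_{i-1}\geq 0$, and \[ w'_{ijkla}=[x_j,x_k]x_j^{a_j}\cdots x_{i-1}^{a_{i-1}}[x_i,x_l]+[x_j,x_l]x_j^{a_j}\cdots x_{i-1}^{a_{i-1}}[x_i,x_k], \] \[ w''_{ijkla}=[x_j,x_l]x_j^{a_j}\cdots x_{i-1}^{a_{i-1}}[x_i,x_k]+[x_k,x_l]x_j^{a_j}\cdots x_{i-1}^{a_{i-1}}[x_i,x_j], \] where $i>j>k>l$ and $a_j,\ldots,a_{i-1}\geq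 0$.
   Context: $K\langle X\rangle$ is the free unitary associative $K$-algebra on $X$; $\langle X\rangle$ is its set of words (monomials). $[f,g]=fg-gf$ and $[f,g,h]=[[f,g],h]$. In the products $x_j^{a_j}\cdots x_{i-1}^{a_{i-1}}$ the variables $x_j,x_{j+1},\ldots,x_{i-1}$ appear in increasing order of index, with nonnegative integer exponents. The T-ideal of $K\langle X\rangle$ generated by $[x_1,x_2,x_3]$ is the two-sided ideal generated by all $[f_1,f_2,f_3]$ with $f_1,f_2,f_3\in K\langle X\rangle$. Deg-lex ordering on $\langle X\rangle$: monomials are compared first by total degree and then lexicographically, reading from left to right, with $x_1<x_2<\cdots$. For nonzero $f\in K\langle X\rangle$, $\mathrm{lt}(f)$ is the greatest monomial occurring in $f$ (with nonzero coefficient). A subset $G$ of a two-sided ideal $I$ is a Gröbner basis of $I$ if for every nonzero $f\in I$ there is a $g\in G$ such that $\mathrm{lt}(g)$ is a subword (contiguous factor) of $\mathrm{lt}(f)$. A Gröbner basis $G$ of $I$ is minimal if for every $g\in G$ the set $G\setminus\{g\}$ is not a Gröbner basis of $I$, i.e. $\mathrm{lt}(g)$ does not contain $\mathrm{lt}(h)$ as a subword for any $h\in G\setminus\{g\}$. *)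

(* Defs.v *)
From HB Require Import structures.
From mathcomp Require Import all_boot all_order all_algebra finmap.
From mathcomp.multinomials Require Import monalg.

Set Implicit Arguments.
Unset Strict Implicit.
Unset Printing Implicit Defensive.

Import Order.TTheory GRing.Theory.

Local Open Scope ring_scope.

(* The alphabet has [n] letters if [N = Some n], and is countably infinite if
   [N = None]. Letters are numbered from 0: the letter of index [m] is
   x_{m+1}. *)
Definition in_alphabet (N : option nat) (m : nat) : bool :=
  if N is Some n then (m < n)%N else true.

Record letter (N : option nat) : predArgType :=
  Letter { letter_idx :> nat; _ : in_alphabet N letter_idx }.

HB.instance Definition _ N := [isSub for @letter_idx N].
HB.instance Definition _ N := [Countable of letter N by <:].
HB.instance Definition _ N :=
  [SubChoice_isSubOrder of letter N by <: with Order.NatOrder.nat_display].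

Notation word N := {fmonom (letter N)}.
Notation free_algebra K N := {malg K[word N]}.

(* On words of the same length, the lexicographic order of [seqlexi] is the
   letter by letter one. *)
Definition deglex N (u v : word N) : bool :=
  (size u < size v)%N ||
  (size u == size v) && ((u : seqlexi (letter N)) <= (v : seqlexi (letter N)))%O.

Definition deglex_max N (u v : word N) : word N :=
  if deglex u v then v else u.

(* The empty word is the least one for [deglex], so it does not contribute when
   f != 0; the value at f = 0 is junk. *)
Definition lead_word (K : fieldType) N (f : free_algebra K N) : word N :=
  \big[@deglex_max N/mone]_(w <- msupp f) w.

Definition is_groebner_basis (K : fieldType) N
    (I G : free_algebra K N -> Prop) : Prop :=
  (forall g, G g -> I g) /\
  (forall f, I f -> f != 0 ->
     exists g, [/\ G g, g != 0 & infix (lead_word g) (lead_word f)]).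

Definition is_minimal_groebner_basis (K : fieldType) N
    (I G : free_algebra K N -> Prop) : Prop :=
  is_groebner_basis I G /\
  (forall g, G g -> ~ is_groebner_basis I (fun h => G h /\ h <> g)).

Inductive ideal_generated_by (A : nzRingType) (S : A -> Prop) : A -> Prop :=
| Ideal_gen f of S f : ideal_generated_by S f
| Ideal_0 : ideal_generated_by S 0
| Ideal_add f g of ideal_generated_by S f & ideal_generated_by S g :
    ideal_generated_by S (f + g)
| Ideal_mull h f of ideal_generated_by S f : ideal_generated_by S (h * f)
| Ideal_mulr f h of ideal_generated_by S f : ideal_generated_by S (f * h).

Definition commr (A : nzRingType) (f g : A) : A := f * g - g * f.

Local Notation "<[ f , g ]>" := (commr f g) (format "<[ f ,  g ]>").

Definition tideal_comm3 (K : fieldType) N : free_algebra K N -> Prop :=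
  ideal_generated_by
    (fun f => exists f1 f2 f3, f = <[ <[ f1, f2 ]>, f3 ]>).

Definition letters_between N (j i : letter N) : seq (letter N) :=
  pmap insub (index_iota j i).

Lemma letters_betweenE N (j i : letter N) :
  [seq letter_idx l | l <- letters_between j i] = index_iota j i.
Proof.
rewrite /letters_between (pmap_filter (insubK _)); apply/all_filterP/allP => m.
rewrite mem_index_iota isSome_insub => /andP[_ lt_mi].
have down M n : in_alphabet M n -> (m < n)%N -> in_alphabet M m.
  by case: M => //= M lt_nM lt_mn; apply: ltn_trans lt_nM.
exact: down (valP i) lt_mi.
Qed.

Section Polynomials.

Variables (K : fieldType) (N : option nat).
Implicit Types (i j k l : letter N) (a : letter N -> nat).

Definition var i : free_algebra K N := << fmu i >>.

Local Notation x := var.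

(* x_j^{a_j} ... x_{i-1}^{a_{i-1}}, in increasing order of the indices; only
   the values of [a] between [j] and [i - 1] matter. *)
Definition power_prod j i a : free_algebra K N :=
  \prod_(m <- letters_between j i) x m ^+ a m.

Definition gb_f' i j := <[ <[ x i, x j ]>, x j ]>.
Definition gb_f'' i j := <[ x i, <[ x i, x j ]> ]>.
Definition gb_g' i j k := <[ x i, <[ x j, x k ]> ]>.
Definition gb_g'' i k j := <[ <[ x i, x k ]>, x j ]>.
Definition gb_t i j := <[ x i, x j ]> * <[ x i, x j ]>.
Definition gb_u' i j k := <[ x i, x j ]> * <[ x i, x k ]>.
Definition gb_u'' i j k := <[ x i, x k ]> * <[ x i, x j ]>.
Definition gb_v' i j k a := <[ x j, x k ]> * power_prod j i a * <[ x i, x k ]>.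
Definition gb_v'' i j k a := <[ x j, x k ]> * power_prod j i a * <[ x i, x j ]>.
Definition gb_w' i j k l a :=
  <[ x j, x k ]> * power_prod j i a * <[ x i, x l ]> +
  <[ x j, x l ]> * power_prod j i a * <[ x i, x k ]>.
Definition gb_w'' i j k l a :=
  <[ x j, x l ]> * power_prod j i a * <[ x i, x k ]> +
  <[ x k, x l ]> * power_prod j i a * <[ x i, x j ]>.

Inductive grassmann_basis : free_algebra K N -> Prop :=
| Basis_f' i j of (j < i)%N : grassmann_basis (gb_f' i j)
| Basis_f'' i j of (j < i)%N : grassmann_basis (gb_f'' i j)
| Basis_g' i j k of (k < j < i)%N : grassmann_basis (gb_g' i j k)
| Basis_g'' i j k of (k < j < i)%N : grassmann_basis (gb_g'' i k j)
| Basis_t i j of (j < i)%N : grassmann_basis (gb_t i j)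
| Basis_u' i j k of (k < j < i)%N : grassmann_basis (gb_u' i j k)
| Basis_u'' i j k of (k < j < i)%N : grassmann_basis (gb_u'' i j k)
| Basis_v' i j k a of (k < j < i)%N : grassmann_basis (gb_v' i j k a)
| Basis_v'' i j k a of (k < j < i)%N : grassmann_basis (gb_v'' i j k a)
| Basis_w' i j k l a of (l < k < j)%N & (j < i)%N :
    grassmann_basis (gb_w' i j k l a)
| Basis_w'' i j k l a of (l < k < j)%N & (j < i)%N :
    grassmann_basis (gb_w'' i j k l a).

End Polynomials.

(* Main.v *)
Require Import Defs.
From mathcomp Require Import all_boot all_order all_algebra finmap.
From mathcomp Require Import ring zify.
From mathcomp.multinomials Require Import monalg.

(** Modulo the T-ideal generated by [x1, x2, x3] every commutator is central.
    Moreover [f, h][g, k] + [f, k][g, h] vanishes, because [[f g, h], k] is the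
    sum of this element and of multiples of triple commutators; away from
    characteristic 2 it follows that [f, h][g, h] vanishes. This places all the
    polynomials of the list in the T-ideal (basis_in_ideal).

    Their leading words have only two shapes: the cubic words i b c with c < i
    and b <= i, and the pair words j b P i c, in which two descents j > b and
    i > c with j <= i and c <= j are separated by an ascending word P in the
    letters from j to i - 1. A pair word has no descent besides those at its
    two ends, so that no leading word is a factor of another one; as each
    polynomial of the list is determined by its leading word, minimality
    follows (basis_antichain).

    A word w without factors of these two shapes is rigid (normal_or_lead): it
    is a weakly ascending word in which some letters j1 < j2 < ... are followed,
    at their first occurrence, by an extra letter b1, b2, ..., where
    b1 < j1 < b2 < j2 < ... It remains to see that such a w is not the leading
    word of an element f of the T-ideal. It is enough to exhibit a linear
    functional that vanishes on the T-ideal, takes the value 1 at w and vanishes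
    at all words smaller than w: its value at f is then the leading coefficient
    of f, and f = 0. No reduction of f is required.

    The functional comes from a Grassmann algebra with generators e_i. Attach
    to a word u the product of the factors 1 + e_a e_b over the inversions of u,
    that is, the pairs of positions at which a letter a precedes a smaller
    letter b. Exchanging two adjacent factors f and g of a word multiplies this
    product by 1 + eta_f eta_g, where eta_f is the sum of e over the letters of
    f (inv_prod_exchange). A triple commutator [f, g, h] between two words is
    therefore sent to a multiple of eta_f eta_g (eta_f + eta_g) eta_h = 0
    (inv_prod_comm3). The functional is zero at the words that are not
    rearrangements of w. At a rearrangement u of w it is the coefficient in the
    product of the monomial of all e_j, e_b with (j, b) a pair of w, the other
    generators being replaced by 0. In w the only inversions between letters of
    pairs are the pairs themselves, whence the value 1 (inv_prod_normal and
    top_coef_pairs). If u < w, then at the first place where they differ u puts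
    the extra letter b of a pair before everything that could form an inversion
    with it: e_b does not occur in the product, and its coefficient vanishes
    (normal_max). *)

Set Implicit Arguments.
Unset Strict Implicit.
Unset Printing Implicit Defensive.

Import Order.TTheory GRing.Theory.

Local Open Scope ring_scope.

(** * Products over the inversions of a word *)

Section InversionProduct.

Variables (N : option nat) (A : nzRingType) (e : letter N -> A).
Hypothesis e_anti : forall i j, e i * e j = - (e j * e i).
Hypothesis e_sq : forall i, e i * e i = 0.

Implicit Types (i j l : letter N) (u v p q f g h : seq (letter N)).

Definition eta u : A := \sum_(l <- u) e l.

Definition below i u := [seq l : letter N <- u | (l < i)%N].

(** The product of the factors 1 + e a * e b over the inversions of u. For a
    fixed first letter i the product of the 1 + e i * e l collapses to one plus
    the sum of the e i * e l, since e i * e l * e i = 0. *)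
Fixpoint inv_prod u : A :=
  if u is i :: u' then
    (1 + e i * eta (below i u')) * inv_prod u'
  else 1.

Lemma eta_cons i u : eta (i :: u) = e i + eta u.
Proof. exact: big_cons. Qed.

Lemma eta_cat u v : eta (u ++ v) = eta u + eta v.
Proof. exact: big_cat. Qed.

Lemma eta1 i : eta [:: i] = e i.
Proof. exact: big_seq1. Qed.

Lemma perm_eta u v : perm_eq u v -> eta u = eta v.
Proof. exact: perm_big. Qed.

Lemma eta_anti u v : eta u * eta v = - (eta v * eta u).
Proof.
rewrite /eta mulr_suml mulr_sumr -sumrN; apply: eq_bigr => i _.
by rewrite mulr_sumr mulr_suml -sumrN; apply: eq_bigr => j _; apply: e_anti.
Qed.

Lemma eta_sq u : eta u * eta u = 0.
Proof.
elim: u => [|i u IHu]; first by rewrite /eta big_nil mul0r.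
rewrite eta_cons mulrDl !mulrDr IHu e_sq add0r addr0 -(eta1 i) eta_anti.
exact: addNr.
Qed.

Lemma eta_sandwich u v : eta u * eta v * eta u = 0.
Proof. by rewrite -mulrA (eta_anti v) mulrN mulrA eta_sq mul0r oppr0. Qed.

Lemma eta2_comm u v w : GRing.comm (eta u * eta v) (eta w).
Proof.
by rewrite /GRing.comm mulrA (eta_anti w u) mulNr -!mulrA (eta_anti w v) mulrN
  opprK.
Qed.

Lemma eta2_comm2 u v u' v' : GRing.comm (eta u * eta v) (eta u' * eta v').
Proof. by apply: commrM; apply: eta2_comm. Qed.

Lemma factor_comm u v u' v' :
  GRing.comm (1 + eta u * eta v) (1 + eta u' * eta v').
Proof.
apply: commrD; first exact: commr1.
by apply/commr_sym/commrD; [apply: commr1 | apply: eta2_comm2].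
Qed.

Lemma inv_prod_cons i u :
  inv_prod (i :: u) =
  (1 + eta [:: i] * eta (below i u)) * inv_prod u.
Proof. by rewrite eta1. Qed.

Lemma inv_prod_swap_gt i j q : (j < i)%N ->
  inv_prod (i :: j :: q) =
  (1 + eta [:: i] * eta [:: j]) * inv_prod (j :: i :: q).
Proof.
move=> lt_ji; rewrite !inv_prod_cons /= lt_ji ltnNge (ltnW lt_ji) /= !mulrA.
congr (_ * _); rewrite (eta_cons j (below i q)) -(eta1 j) -[RHS]mulrA.
rewrite [X in _ = _ * X]factor_comm mulrA; congr (_ * _).
rewrite mulrDl !mulrDr !mul1r mulr1 mulrA eta_sandwich mul0r addr0.
by rewrite -!addrA [eta _ * _ + _ in LHS]addrC.
Qed.

Lemma inv_prod_swap i j q :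
  inv_prod (i :: j :: q) =
  (1 + eta [:: i] * eta [:: j]) * inv_prod (j :: i :: q).
Proof.
case: (ltngtP j i) => [|lt_ij|eq_ij]; first exact: inv_prod_swap_gt.
  rewrite (inv_prod_swap_gt _ lt_ij) mulrA (eta_anti [:: j]).
  rewrite [X in _ = X * _]mulrBr mulr1 [(1 + _) * (_ * _)]mulrDl mul1r.
  by rewrite [_ * (eta _ * _)]mulrA eta_sandwich mul0r addr0 addrK mul1r.
by rewrite (val_inj eq_ij) eta_sq addr0 mul1r.
Qed.

Lemma inv_prod_move i g q :
  inv_prod (i :: g ++ q) = (1 + eta [:: i] * eta g) * inv_prod (g ++ i :: q).
Proof.
elim: g => [|j g IHg]; first by rewrite [eta [::]]big_nil mulr0 addr0 mul1r.
rewrite !cat_cons inv_prod_swap.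
rewrite [inv_prod (j :: i :: _)]inv_prod_cons IHg.
have perm_gq : perm_eq (i :: g ++ q) (g ++ i :: q).
  by rewrite -(cat1s i q) perm_sym perm_catCA.
rewrite (perm_eta (perm_filter _ perm_gq)) [_ * (_ * inv_prod _)]mulrA.
rewrite [(1 + eta [:: j] * _) * _]factor_comm -mulrA -inv_prod_cons mulrA.
congr (_ * _); rewrite -(cat1s j g) eta_cat.
rewrite mulrDl mul1r !mulrDr mulr1 [_ * (eta _ * eta g)]mulrA eta_sandwich.
by rewrite mul0r addr0 -addrA [_ + eta [:: i] * eta [:: j]]addrC.
Qed.

Lemma inv_prod_transpose f g q :
  inv_prod (f ++ g ++ q) = (1 + eta f * eta g) * inv_prod (g ++ f ++ q).
Proof.
elim: f => [|i f IHf]; first by rewrite [eta [::]]big_nil mul0r addr0 mul1r.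
rewrite cat_cons inv_prod_cons IHf.
rewrite (perm_eta (perm_filter _ (permEl (perm_catCA f g q)))).
rewrite mulrA factor_comm -mulrA -inv_prod_cons inv_prod_move mulrA.
congr (_ * _); rewrite (eta_cons i f) -(eta1 i).
have figg0 : eta f * eta g * (eta [:: i] * eta g) = 0.
  by rewrite [eta [:: i] * _]eta_anti mulrN mulrA -(mulrA (eta f)) eta_sq
    mulr0 mul0r oppr0.
rewrite [LHS]mulrDr mulr1 [(_ + _) * (eta _ * _)]mulrDl mul1r figg0 addr0.
by rewrite mulrDl -!addrA [eta f * _ + _]addrC.
Qed.

(** The exchange replaces the inversions from f to g by those from g to f.
    Since e a * e b = - (e b * e a), the sum of the products e a * e b over the
    former minus that over the latter is the sum over all pairs of a letter a
    of f and a letter b of g, whatever their order: it is eta f * eta g. *)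
Lemma inv_prod_exchange p f g q :
  inv_prod (p ++ f ++ g ++ q) =
  (1 + eta f * eta g) * inv_prod (p ++ g ++ f ++ q).
Proof.
elim: p => [|i p IHp]; first by rewrite !cat0s inv_prod_transpose.
rewrite !cat_cons !inv_prod_cons IHp.
have perm_pq : perm_eq (p ++ f ++ g ++ q) (p ++ g ++ f ++ q).
  by rewrite perm_cat2l perm_catCA.
by rewrite (perm_eta (perm_filter _ perm_pq)) mulrA factor_comm mulrA.
Qed.

(** Exchanging f and g produces the factor eta f * eta g on either side of h.
    Moving h across g ++ f changes the product by a multiple of
    eta (g ++ f) = eta g + eta f, which this factor annihilates. *)
Lemma inv_prod_comm3 p f g h q :
  inv_prod (p ++ f ++ g ++ h ++ q) - inv_prod (p ++ g ++ f ++ h ++ q)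
    - inv_prod (p ++ h ++ f ++ g ++ q) + inv_prod (p ++ h ++ g ++ f ++ q) = 0.
Proof.
have kill : eta f * eta g * (eta (g ++ f) * eta h) = 0.
  rewrite eta_cat mulrA mulrDr eta_sandwich -mulrA eta_sq mulr0 add0r.
  exact: mul0r.
have -> : inv_prod (p ++ f ++ g ++ h ++ q)
    = (1 + eta f * eta g) * inv_prod (p ++ g ++ f ++ h ++ q).
  exact: inv_prod_exchange.
have -> : inv_prod (p ++ h ++ f ++ g ++ q)
    = (1 + eta f * eta g) * inv_prod (p ++ h ++ g ++ f ++ q).
  by rewrite !(catA p h) inv_prod_exchange.
have -> : inv_prod (p ++ g ++ f ++ h ++ q)
    = (1 + eta (g ++ f) * eta h) * inv_prod (p ++ h ++ g ++ f ++ q).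
  by rewrite (catA g f) inv_prod_exchange -catA.
rewrite !mulrDl !mul1r mulrDr mulrA kill mul0r addr0.
by rewrite [_ + _ * _ - _]addrC addKr opprD addrCA subrr addr0 addNr.
Qed.

End InversionProduct.

(** * Matrices representing a Grassmann algebra *)

(** The Grassmann algebra on the generators in s, acting on itself: gm_e i is
    the multiplication by a generator, and the entry at (gm_row, gm_col) is the
    coefficient of the product of all generators. The contractions gm_d serve to
    say that an element does not involve a generator: it then commutes with the
    contraction, provided that it is even. *)
Record grassmann_model (K : nzRingType) (T : eqType) (s : seq T) :=
  GrassmannModel {
    gm_dim : nat;
    gm_e : T -> 'M[K]_(gm_dim.+1);
    gm_d : T -> 'M[K]_(gm_dim.+1);
    gm_row : 'I_gm_dim.+1;
    gm_col : 'I_gm_dim.+1;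
    gm_anti : forall i j, gm_e i * gm_e j = - (gm_e j * gm_e i);
    gm_sq : forall i, gm_e i * gm_e i = 0;
    gm_out : forall i, i \notin s -> gm_e i = 0;
    gm_dN : forall b i, b \in s -> i != b ->
      gm_d b * gm_e i = - (gm_e i * gm_d b);
    gm_d1 : forall b, b \in s -> gm_e b * gm_d b + gm_d b * gm_e b = 1;
    gm_row0 : forall b x, b \in s -> (gm_d b * x) gm_row gm_col = 0;
    gm_col0 : forall b x, b \in s -> (x * gm_d b) gm_row gm_col = 0;
    gm_top : (\prod_(i <- s) gm_e i) gm_row gm_col = 1
  }.

Section FockSpace.

Variables (K : nzRingType) (T : eqType).
Implicit Types (s : seq T) (t i b : T).

Lemma grassmann_model_nil : grassmann_model K ([::] : seq T).
Proof.
apply: (@GrassmannModel K T [::] 0%N (fun=> 0) (fun=> 0) ord0 ord0) => //.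
- by move=> i j; rewrite mulr0 oppr0.
- by move=> i; rewrite mulr0.
- by rewrite big_nil mxE.
Qed.

Section Extension.

Variables (s : seq T) (t : T) (m : grassmann_model K s).
Hypothesis s'_t : t \notin s.

Let n := gm_dim m.
Let e := @gm_e _ _ _ m.
Let d := @gm_d _ _ _ m.

Let block := @block_mx K n.+1 n.+1 n.+1 n.+1.

Let blockM (x y z w x' y' z' w' : 'M[K]_n.+1) :
  block x y z w * block x' y' z' w' =
  block (x * x' + y * z') (x * y' + y * w') (z * x' + w * z') (z * y' + w * w').
Proof. exact: mulmx_block. Qed.

Let e' i := if i == t then block 0 1 0 0 else block (- e i) 0 0 (e i).
Let d' i := if i == t then block 0 0 1 0 else block (- d i) 0 0 (d i).
Let row' : 'I_(n.+1 + n.+1) := lshift _ (gm_row m).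
Let col' : 'I_(n.+1 + n.+1) := rshift _ (gm_col m).

Let block_corner x y z w : block x y z w row' col' = y (gm_row m) (gm_col m).
Proof. exact: block_mxEur. Qed.

Let blockN x y z w : - block x y z w = block (- x) (- y) (- z) (- w).
Proof. exact: opp_block_mx. Qed.

Let blockD x y z w x' y' z' w' :
  block x y z w + block x' y' z' w' = block (x + x') (y + y') (z + z') (w + w').
Proof. exact: add_block_mx. Qed.

Let block1 : block 1 0 0 1 = 1.
Proof. by rewrite /block -scalar_mx_block. Qed.

Let blockE (x : 'M[K]_(n.+1 + n.+1)) :
  exists x1 x2 x3 x4, x = block x1 x2 x3 x4.
Proof.
pose p := n.+1.
exists (@ulsubmx _ p p p p x), (@ursubmx _ p p p p x).
exists (@dlsubmx _ p p p p x), (@drsubmx _ p p p p x).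
by rewrite /block (@submxK _ p p p p).
Qed.

Local Notation simp := (mulr0, mul0r, mulr1, mul1r, addr0, add0r, oppr0, mulrNN,
  mulNr, mulrN, opprK).

(** The Grassmann algebra on t and s is the sum of two copies of the one on s.
    Multiplication by t maps one copy onto the other and kills the latter; the
    old generators act with opposite signs on the two copies, so as to
    anticommute with t. *)
Lemma grassmann_model_cons : grassmann_model K (t :: s).
Proof.
apply: (@GrassmannModel K T (t :: s) (n + n.+1)%N e' d' row' col').
- move=> i j; rewrite /e'.
  by case: ifP => _; case: ifP => _; rewrite !blockM blockN !simp // gm_anti
    ?opprK.
- by move=> i; rewrite /e'; case: ifP => _; rewrite blockM !simp ?gm_sq
    -/n ?/block ?block_mx0.
- move=> i; rewrite inE negb_or /e' => /andP[/negbTE-> s'i].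
  by rewrite /e gm_out // oppr0 /block block_mx0.
- move=> b i; rewrite inE /e' /d'.
  case: (eqVneq b t) => [-> _|_ /= sb]; case: (eqVneq i t) => [_|_] neq_ib.
  + by [].
  + by rewrite !blockM blockN !simp.
  + by rewrite !blockM blockN !simp.
  + by rewrite !blockM blockN !simp gm_dN.
- move=> b; rewrite inE /e' /d'; case: (eqVneq b t) => [_ _|_ /= sb].
    by rewrite !blockM blockD !simp block1.
  by rewrite !blockM blockD !simp gm_d1 // block1.
- move=> b x; have [x1 [x2 [x3 [x4 ->]]]] := blockE x.
  rewrite inE /d'; case: (eqVneq b t) => [_ _|_ /= sb].
    by rewrite blockM block_corner !simp mxE.
  by rewrite blockM block_corner !simp mxE gm_row0 // oppr0.
- move=> b x; have [x1 [x2 [x3 [x4 ->]]]] := blockE x.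
  rewrite inE /d'; case: (eqVneq b t) => [_ _|_ /= sb].
    by rewrite blockM block_corner !simp mxE.
  by rewrite blockM block_corner !simp gm_col0.
rewrite big_cons {1}/e' eqxx.
suff blocks u : t \notin u -> exists x y, \prod_(i <- u) e' i =
    block x 0 y (\prod_(i <- u) e i).
  have [x [y ->]] := blocks s s'_t.
  by rewrite blockM block_corner !simp gm_top.
elim: u => [|i u IHu].
  by move=> _; exists 1, 0; rewrite !big_nil block1.
rewrite inE negb_or eq_sym => /andP[/negbTE i_t /IHu[x [y eq_u]]].
by rewrite !big_cons eq_u {1}/e' i_t blockM !simp; do 2!eexists.
Qed.

End Extension.

Lemma grassmann_modelP s : uniq s -> grassmann_model K s.
Proof.
elim: s => [_|t s IHs]; first exact: grassmann_model_nil.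
by rewrite cons_uniq => /andP[s't /IHs m]; apply: grassmann_model_cons.
Qed.

End FockSpace.

Section TopCoefficient.

Variables (K : nzRingType) (T : eqType) (s : seq T) (m : grassmann_model K s).

Local Notation e := (gm_e m).
Local Notation d := (gm_d m).

Definition top_coef (x : 'M[K]_((gm_dim m).+1)) : K := x (gm_row m) (gm_col m).

Lemma top_coefD x y : top_coef (x + y) = top_coef x + top_coef y.
Proof. exact: mxE. Qed.

Lemma top_coefB x y : top_coef (x - y) = top_coef x - top_coef y.
Proof. by rewrite /top_coef !mxE. Qed.

(** As e b * d b + d b * e b = 1, the element x is the sum of x * e b * d b and
    of d b * x * e b, and both have d b at an end. *)
Lemma top_coef_free b x : b \in s -> GRing.comm x (d b) -> top_coef x = 0.
Proof.
move=> s_b comm_xd; rewrite -[x]mulr1 -(gm_d1 m s_b) mulrDr top_coefD.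
rewrite {1}/top_coef !mulrA gm_col0 // add0r comm_xd -mulrA.
exact: gm_row0.
Qed.

Lemma even_comm_annihilator b i j : b \in s -> i != b -> j != b ->
  GRing.comm (e i * e j) (d b).
Proof.
move=> sb ib jb; rewrite /GRing.comm mulrA gm_dN // mulNr -!mulrA.
by rewrite (gm_dN _ sb jb) mulrN opprK.
Qed.

Definition pair_letters (ps : seq (T * T)) : seq T :=
  flatten [seq [:: jb.1; jb.2] | jb <- ps].

Lemma pair_prod_comm b (ps : seq (T * T)) : b \in s ->
  b \notin pair_letters ps ->
  GRing.comm (\prod_(jb <- ps) (1 + e jb.1 * e jb.2)) (d b).
Proof.
move=> sb; elim: ps => [|[i j] ps IHps] /=.
  by rewrite big_nil => _; apply/commr_sym/commr1.
rewrite !inE !negb_or big_cons => /and3P[bi bj /IHps comm_ps].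
apply/commr_sym/commrM; last exact/commr_sym.
apply: commrD; first exact: commr1.
by apply/commr_sym/even_comm_annihilator; rewrite // eq_sym.
Qed.

(** Expanding a factor 1 + e j * e b leaves one relevant term: in the other
    one the generator b no longer occurs. The element x accumulates the factors
    already expanded. *)
Lemma top_coef_pair_prod (ps : seq (T * T)) x : uniq (pair_letters ps) ->
  {subset pair_letters ps <= s} ->
  {in pair_letters ps, forall b, GRing.comm x (d b)} ->
  top_coef (x * \prod_(jb <- ps) (1 + e jb.1 * e jb.2)) =
  top_coef (x * \prod_(i <- pair_letters ps) e i).
Proof.
elim: ps x => [|[j b] ps IHps] x /=; first by rewrite !big_nil.
case/and3P; rewrite inE negb_or => /andP[jb j_ps] b_ps /IHps{}IHps sub_s comm_x.
rewrite !big_cons mulrDl mul1r mulrDr top_coefD.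
have sb : b \in s by apply: sub_s; rewrite !inE eqxx orbT.
rewrite (top_coef_free sb) ?add0r; last first.
  apply/commr_sym/commrM; first by apply/commr_sym/comm_x;
    rewrite !inE eqxx orbT.
  exact/commr_sym/pair_prod_comm.
rewrite !mulrA IHps // ?mulrA // => l ps_l.
  by apply: sub_s; rewrite !inE ps_l !orbT.
have sl : l \in s by apply: sub_s; rewrite !inE ps_l !orbT.
rewrite -mulrA; apply/commr_sym/commrM.
  by apply/commr_sym/comm_x; rewrite !inE ps_l !orbT.
apply/commr_sym/even_comm_annihilator => //.
  by apply: contraNneq j_ps => /= ->.
by apply: contraNneq b_ps => /= ->.
Qed.

End TopCoefficient.

Arguments top_coef {K T s} m x.

Lemma top_coef_pairs (K : nzRingType) (T : eqType) (ps : seq (T * T))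
    (m : grassmann_model K (pair_letters ps)) : uniq (pair_letters ps) ->
  top_coef m (\prod_(jb <- ps) (1 + gm_e m jb.1 * gm_e m jb.2)) = 1.
Proof.
move=> uniq_ps; rewrite -[X in top_coef m X]mul1r top_coef_pair_prod //.
  by rewrite mul1r; apply: gm_top.
by move=> b _; apply/commr_sym/commr1.
Qed.

(** * Words without leading factors *)

Section NormalWords.

Variable N : option nat.
Implicit Types (i j k l b : letter N) (u w : seq (letter N)).
Implicit Types (ps : seq (letter N * letter N)) (c m : nat).

(** Weakly ascending words in which some letters i, at their first occurrence,
    are followed by an extra letter b < i; ps lists these pairs (i, b). In the
    course of reading, c is 0 or the successor of the last letter of the
    ascending part, so that a letter i with c <= i occurs for the first time,
    and m is 0 or the successor of the first component of the last pair: all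
    extra letters that follow are at least m. *)
Inductive normal :
    nat -> nat -> seq (letter N) -> seq (letter N * letter N) -> Prop :=
| Normal_nil c m : normal c m [::] [::]
| Normal_up c m i w ps of (c <= i.+1)%N & normal i.+1 m w ps :
    normal c m (i :: w) ps
| Normal_down c m i b w ps of (c <= i)%N & (m <= b < i)%N &
    normal i.+1 i.+1 w ps : normal c m (i :: b :: w) ((i, b) :: ps).

Lemma le_letterE i j : (i <= j)%O = (i <= j)%N.
Proof. by []. Qed.

Lemma normal_pairs c m w ps j b : normal c m w ps -> (j, b) \in ps ->
  (c <= j)%N && (m <= b < j)%N.
Proof.
elim=> {c m w ps} [|c m i w ps le_ci _ IHw|c m i b' w ps le_ci bP _ IHw] //.
  by move/IHw => /andP[lt_ij ->]; rewrite (leq_trans le_ci).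
rewrite inE => /orP[/eqP[-> ->]|/IHw]; first by rewrite le_ci.
case/andP=> lt_ij /andP[lt_ib ->];
  rewrite !andbT (leq_trans le_ci (ltnW lt_ij)).
by case/andP: bP => le_mb' lt_b'i;
  rewrite (leq_trans le_mb') // ltnW // (ltn_trans lt_b'i).
Qed.

Lemma normal_bottom c m w ps b : normal c m w ps -> b \in unzip2 ps ->
  (m <= b)%N.
Proof.
by move=> w_ps /mapP[[j b'] ps_jb ->]; case/and3P: (normal_pairs w_ps ps_jb).
Qed.

Lemma mem_pair_letters ps l :
  (l \in pair_letters ps) = (l \in unzip1 ps) || (l \in unzip2 ps).
Proof.
elim: ps => [|[j b] ps IHps] //=; rewrite !inE [_ \in flatten _]IHps.
by case: (l == j); case: (l == b); rewrite ?orbT.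
Qed.

Lemma normal_pair_letter c m w ps l : normal c m w ps ->
  l \in pair_letters ps ->
  (m <= l)%N.
Proof.
move=> w_ps; rewrite mem_pair_letters => /orP[] /mapP[[j b] ps_jb ->];
  by case/and3P: (normal_pairs w_ps ps_jb) => // _ le_mb /ltnW;
    apply: leq_trans.
Qed.

Lemma normal_letter c m w ps l : normal c m w ps -> l \in w ->
  (c <= l.+1)%N || (l \in unzip2 ps).
Proof.
elim=> {c m w ps} [|c m i w ps le_ci _ IHw|c m i b w ps le_ci bP _ IHw] //.
  rewrite inE => /orP[/eqP->|/IHw/orP[|->]];
    [by rewrite le_ci| |by rewrite orbT].
  by move/(leq_trans le_ci)=> ->.
rewrite /= !inE => /or3P[/eqP->|/eqP->|/IHw/orP[|->]]; rewrite ?eqxx ?orbT //.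
  by rewrite leqW.
by move/ltnW/(leq_trans le_ci)=> ->.
Qed.

Lemma normal_after_descent i w ps l : normal i.+1 i.+1 w ps -> l \in w ->
  (i <= l)%N.
Proof.
move=> w_ps /(normal_letter w_ps)/orP[//|/(normal_bottom w_ps)].
exact: ltnW.
Qed.

Lemma normal_uniq c m w ps : normal c m w ps -> uniq (pair_letters ps).
Proof.
elim=> {c m w ps} [|c m i w ps le_ci _ IHw|c m i b w ps le_ci bP w_ps IHw] //.
rewrite /= IHw inE negb_or andbT.
have /andP[_ lt_bi] := bP; apply/andP; split.
  apply/andP; split; first by apply: contraTneq lt_bi => ->; rewrite ltnn.
  by apply/negP=> /(normal_pair_letter w_ps); rewrite ltnn.
by apply/negP=> /(normal_pair_letter w_ps); rewrite ltnNge (ltnW lt_bi).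
Qed.

Lemma normal_bottom_uniq c m w ps b b' : normal c m w ps ->
  b \in unzip2 ps -> b' \in unzip2 ps -> (b < c)%N -> (b' < c)%N -> b = b'.
Proof.
elim=> {c m w ps} [|c m i w ps le_ci _ IHw|c m i b0 w ps le_ci bP w_ps IHw] //.
  move=> ps_b ps_b' lt_bc lt_b'c.
  by apply: IHw; rewrite // (leq_trans _ le_ci).
have late l : l \in unzip2 ps -> (l < c)%N = false.
  move/(normal_bottom w_ps) => lt_il; apply/negbTE; rewrite -leqNgt.
  by rewrite (leq_trans le_ci) // ltnW.
by rewrite !inE => /orP[/eqP->|/late->//] /orP[/eqP->|/late->].
Qed.

(** The extra letter of a pair is larger than the first component of the
    previous pair, so only the first pair has an extra letter below c. *)
Lemma normal_count c m w ps : normal c m w ps ->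
  (count (fun l : letter N => l.+1 < c)%N w <= 1)%N.
Proof.
elim=> {c m w ps} [|c m i w ps le_ci _ IHw|c m i b w ps le_ci bP w_ps _] //=.
  rewrite ltnNge le_ci; apply: leq_trans IHw; apply: sub_count => l /= lt_lc.
  exact: leq_trans le_ci.
rewrite ltnNge (leq_trans le_ci) //= add0n -[X in (_ <= X)%N]addn0.
rewrite leq_add ?leq_b1 // leqn0 -[_ == _]negbK -lt0n -has_count.
apply/hasPn => l /(normal_after_descent w_ps) le_il.
by rewrite -leqNgt (leq_trans le_ci) // ltnW.
Qed.

(** A letter i of the ascending part has inversions only with an extra letter l
    that comes later, the b of the next pair (j, b): here b < i < j. Such an i
    belongs neither to this pair nor to a later one, whose letters are larger
    than j, nor to an earlier one, whose letters are less than m. *)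
Lemma normal_up_clash i m w ps l : normal i.+1 m w ps -> l \in w -> (l < i)%N ->
  (m <= i)%N && (i \notin pair_letters ps).
Proof.
move=> w_ps w_l lt_li; have /orP[|ps_l] := normal_letter w_ps w_l.
  by rewrite ltnS leqNgt lt_li.
rewrite (leq_trans (normal_bottom w_ps ps_l) (ltnW lt_li)) /=.
rewrite mem_pair_letters negb_or; apply/andP; split.
  apply/mapP=> -[[j b] ps_jb /= eq_ij]; case/andP: (normal_pairs w_ps ps_jb).
  by rewrite eq_ij ltnn.
apply/negP=> ps_i; have := normal_bottom_uniq w_ps ps_l ps_i.
by move/(_ (leqW lt_li) (leqnn _))=> eq_li; rewrite eq_li ltnn in lt_li.
Qed.

Section Product.

Variables (A : nzRingType) (e : letter N -> A).

(** The letters less than m may belong to pairs that were read before. They have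
    no inversion with what follows, so nothing is required of them. *)
Definition supported m ps :=
  forall i, (m <= i)%N -> i \notin pair_letters ps -> e i = 0.

Lemma supported_down m i b ps : (m <= b < i)%N -> supported m ((i, b) :: ps) ->
  supported i.+1 ps.
Proof.
case/andP=> le_mb lt_bi supp j lt_ij ps_j; apply: supp.
  by rewrite (leq_trans le_mb) // ltnW // (ltn_trans lt_bi).
rewrite !inE !negb_or -!(inj_eq val_inj) /= !neq_ltn lt_ij.
by rewrite (ltn_trans lt_bi lt_ij) !orbT.
Qed.

Lemma below_nil i u : (forall l, l \in u -> (i <= l)%N) -> below i u = [::].
Proof.
move=> le_iu; apply/eqP; rewrite -[_ == _]negbK -has_filter -all_predC.
by apply/allP => l /le_iu; rewrite /= -leqNgt.
Qed.

Lemma normal_up_inversion i m w ps u : normal i.+1 m w ps -> perm_eq u w ->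
  supported m ps -> e i * eta e (below i u) = 0.
Proof.
move=> w_ps uw supp; case: (posnP (size (below i u))) => [/size0nil->|].
  by rewrite /eta big_nil mulr0.
rewrite -[(0 < _)%N]has_predT => /hasP[l]; rewrite mem_filter (perm_mem uw).
case/andP=> lt_li w_l _.
have /andP[le_mi ps_i] := normal_up_clash w_ps w_l lt_li.
by rewrite supp ?mul0r.
Qed.

(** Only the inversions between letters of pairs count, and these are the pairs
    themselves. *)
Lemma inv_prod_normal c m w ps : normal c m w ps -> supported m ps ->
  inv_prod e w = \prod_(jb <- ps) (1 + e jb.1 * e jb.2).
Proof.
elim=> {c m w ps} [|c m i w ps le_ci w_ps IHw|c m i b w ps le_ci bP w_ps IHw]
  supp /=.
- by rewrite big_nil.
- by rewrite (normal_up_inversion w_ps (perm_refl _)) // addr0 mul1r IHw.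
have /andP[_ lt_bi] := bP.
rewrite lt_bi !below_nil => [||l /(normal_after_descent w_ps)] //; last first.
  by move=> l /(normal_after_descent w_ps); apply/leq_trans/ltnW.
rewrite /eta big_nil big_seq1 mulr0 addr0 mul1r big_cons IHw //.
exact: supported_down supp.
Qed.

Lemma inv_prod_comm (d : A) u :
  {in u &, forall i j, GRing.comm (e i * e j) d} ->
  GRing.comm (inv_prod e u) d.
Proof.
elim: u => [|i u IHu] /= comm_d; first exact/commr_sym/commr1.
apply/commr_sym/commrM; last first.
  apply/commr_sym/IHu => j k uj uk; apply: comm_d; exact: mem_behead.
apply: commrD; first exact: commr1.
rewrite /eta mulr_sumr big_seq; apply: big_ind => [|x y|j].
- exact: commr0.
- exact: commrD.
rewrite mem_filter => /andP[_ u_j]; apply/commr_sym/comm_d;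
  rewrite ?mem_head //.
exact: mem_behead.
Qed.

End Product.

Definition lexi u w := ((u : seqlexi (letter N)) <= (w : seqlexi (letter N)))%O.

Lemma lexi_consE i j u w :
  lexi (i :: u) (j :: w) = (i < j)%N || ((i == j) && lexi u w).
Proof.
rewrite /lexi Order.SeqLexiOrder.lexi_cons !le_letterE -(inj_eq val_inj) /=.
by case: ltngtP.
Qed.

(** The inversion product of u does not involve e b. The elements d of interest
    are the contractions,
      which commute with the products e i * e j free of b. *)
Definition avoids m ps u b :=
  forall (A : nzRingType) (e : letter N -> A) d, supported e m ps ->
    (forall i j, i != b -> j != b -> GRing.comm (e i * e j) d) ->
    GRing.comm (inv_prod e u) d.

(** By the bound on the count, a is the only letter less than i. Hence neither
    a smaller letter nor another copy of a comes after it in u. *)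
Lemma early_letter_avoids m ps a u i w : perm_eq (a :: u) (i :: w) ->
  (a < i)%N -> (count (fun l : letter N => l.+1 < i.+1)%N (i :: w) <= 1)%N ->
  avoids m ps (a :: u) a.
Proof.
move=> auw lt_ai; rewrite -(permP auw) /= ltnS lt_ai add1n ltnS leqn0.
rewrite -[_ == _]negbK -lt0n -has_count -all_predC => /allP late A e d _ comm_d.
have le_iu l : l \in u -> (i <= l)%N by move/late; rewrite /= ltnS -leqNgt.
rewrite /= below_nil => [|l /le_iu le_il];
  last exact: leq_trans (ltnW lt_ai) le_il.
rewrite /eta big_nil mulr0 addr0 mul1r; apply: inv_prod_comm => j k uj uk.
have neq_a l : l \in u -> l != a.
  by move/le_iu; apply: contraTneq => ->; rewrite -ltnNge.
by apply: comm_d; apply: neq_a.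
Qed.

(** Consider the first place where u differs from w, and the letters a < i of u
    and w there. In w an extra letter is less than all that follows it, so i is
    in the ascending part, and a is an extra letter of w that u reads too early:
    everything after it in u is larger than a. Before that place u and w agree,
    and the only inversions that count there are pairs of w. *)
Lemma normal_max c m w ps u : normal c m w ps -> perm_eq u w -> lexi u w ->
  u != w -> exists2 b, b \in pair_letters ps & avoids m ps u b.
Proof.
move=> w_ps; elim: w_ps u => {c m w ps}
  [c m|c m i w ps le_ci w_ps IHw|c m i b w ps le_ci bP w_ps IHw] u.
- by move=> /perm_nilP->.
- case: u => [|a u]; first by move=> /perm_size.
  move=> auw; rewrite lexi_consE => /orP[lt_ai _|].
    exists a.
      have: a \in i :: w by rewrite -(perm_mem auw) mem_head.
      rewrite inE => /orP[/eqP eq_ai|w_a]; first by rewrite eq_ai ltnn in lt_ai.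
      have /orP[|ps_a] := normal_letter w_ps w_a.
        by rewrite ltnS leqNgt lt_ai.
      by rewrite mem_pair_letters ps_a orbT.
    apply: early_letter_avoids auw lt_ai _.
    by rewrite /= ltnn (normal_count w_ps).
  case/andP=> /eqP eq_ai le_uw; move: auw; rewrite eq_ai perm_cons => uw neq_uw.
  have [|b ps_b av_b] := IHw u uw le_uw.
    by apply: contraNneq neq_uw => ->.
  exists b => // A e d supp comm_d /=.
  by rewrite (normal_up_inversion w_ps uw) // addr0 mul1r; apply: av_b.
case: u => [|a u]; first by move=> /perm_size.
move=> auw; rewrite lexi_consE.
have le_iw l : l \in w -> (i <= l)%N by apply: normal_after_descent w_ps.
have /andP[le_mb lt_bi] := bP.
case/orP=> [lt_ai _|].
  exists a.
    have: a \in [:: i, b & w] by rewrite -(perm_mem auw) mem_head.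
    rewrite !inE => /or3P[/eqP eq_ai|->|/le_iw]; rewrite ?orbT //.
      by rewrite eq_ai ltnn in lt_ai.
    by rewrite leqNgt lt_ai.
  apply: early_letter_avoids auw lt_ai _; rewrite /= ltnn ltnS lt_bi.
  rewrite add0n add1n ltnS leqn0.
  rewrite -[_ == _]negbK -lt0n -has_count; apply/hasPn => l /le_iw.
  by rewrite ltnS -leqNgt.
case/andP=> /eqP eq_ai le_u1w; move: auw; rewrite {}eq_ai perm_cons.
case: u le_u1w => [|b' u]; first by move=> _ /perm_size.
rewrite lexi_consE => le_u1w u1w neq_u1w.
have [eq_b'b le_uw] : b' = b /\ lexi u w.
  case/orP: le_u1w => [lt_b'b|/andP[/eqP]] //.
  have: b' \in b :: w by rewrite -(perm_mem u1w) mem_head.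
  rewrite inE => /orP[/eqP eq_b'b|/le_iw];
    first by rewrite eq_b'b ltnn in lt_b'b.
  by rewrite leqNgt (ltn_trans lt_b'b lt_bi).
move: u1w neq_u1w; rewrite eq_b'b perm_cons => uw neq_u1w.
have [|b0 ps_b0 av_b0] := IHw u uw le_uw.
  by apply: contraNneq neq_u1w => ->.
exists b0; first by rewrite /= !inE ps_b0 !orbT.
move=> A e d supp comm_d /=; rewrite lt_bi !below_nil.
- rewrite /eta big_nil big_seq1 mulr0 addr0 mul1r.
  apply/commr_sym/commrM.
    apply: commrD; first exact: commr1.
    have lt_ib0 := normal_pair_letter w_ps ps_b0.
    by apply/commr_sym/comm_d; rewrite -(inj_eq val_inj) /= neq_ltn
      ?(ltn_trans lt_bi) ?lt_ib0.
  by apply/commr_sym/av_b0 => //; apply: supported_down supp.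
- move=> l; rewrite (perm_mem uw) => /le_iw; exact/leq_trans/ltnW.
by move=> l; rewrite (perm_mem uw) => /le_iw.
Qed.

End NormalWords.

(** * The ideal generated by the triple commutators *)

Section Commutators.

Variable A : nzRingType.
Implicit Types f g h : A.

Lemma bracketDl f g h : commr (f + g) h = commr f h + commr g h.
Proof. by rewrite /commr mulrDl mulrDr opprD addrACA. Qed.

Lemma bracketDr f g h : commr f (g + h) = commr f g + commr f h.
Proof. by rewrite /commr mulrDl mulrDr opprD addrACA. Qed.

Lemma bracket0l f : commr 0 f = 0.
Proof. by rewrite /commr mul0r mulr0 subrr. Qed.

Lemma bracket0r f : commr f 0 = 0.
Proof. by rewrite /commr mul0r mulr0 subrr. Qed.

Lemma opp_bracket f g : - commr f g = commr g f.
Proof. exact: opprB. Qed.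

Lemma bracketMl f g h : commr (f * g) h = f * commr g h + commr f h * g.
Proof.
by rewrite /commr mulrBr mulrBl !mulrA subrKA.
Qed.

Lemma comm3_expand f g h y z :
  y * commr (commr f g) h * z =
  y * f * g * h * z - y * g * f * h * z - y * h * f * g * z + y * h * g * f * z.
Proof.
by rewrite /commr !(mulrBl, mulrBr) !mulrA opprB [X in _ + X = _]addrC addrA.
Qed.

Definition comm3_ideal := ideal_generated_by
  (fun f : A => exists f1 f2 f3, f = commr (commr f1 f2) f3).

Lemma comm3_idealN f : comm3_ideal f -> comm3_ideal (- f).
Proof. by rewrite -mulN1r; apply: Ideal_mull. Qed.

Lemma comm3_idealB f g : comm3_ideal f -> comm3_ideal g -> comm3_ideal (f - g).
Proof. by move=> If Ig; apply/Ideal_add/comm3_idealN. Qed.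

Lemma comm3_ideal_commr f g h : comm3_ideal (commr (commr f g) h).
Proof. by apply: Ideal_gen; exists f, g, h. Qed.

(** Expanding [[f1 f2, f3], f4] by the Leibniz rule gives this sum and two
    multiples of triple commutators. *)
Lemma commutator_swap f1 f2 f3 f4 :
  comm3_ideal (commr f1 f3 * commr f2 f4 + commr f1 f4 * commr f2 f3).
Proof.
have -> : commr f1 f3 * commr f2 f4 + commr f1 f4 * commr f2 f3
    = commr (commr (f1 * f2) f3) f4 - f1 * commr (commr f2 f3) f4
      - commr (commr f1 f3) f4 * f2.
  rewrite bracketMl bracketDl bracketMl [commr (_ * f2) _]bracketMl.
  rewrite -[RHS]addrA -opprD [f1 * _ + _]addrC addrACA addrK.
  exact: addrC.
apply: comm3_idealB; last exact/Ideal_mulr/comm3_ideal_commr.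
by apply: comm3_idealB; [|apply: Ideal_mull]; apply: comm3_ideal_commr.
Qed.

Lemma commutator_move f1 f2 p g :
  comm3_ideal (commr f1 f2 * p * g - p * commr f1 f2 * g).
Proof. by rewrite -mulrBl; apply/Ideal_mulr/comm3_ideal_commr. Qed.

Lemma commutator_swap_mid f1 f2 f3 f4 p :
  comm3_ideal (commr f1 f3 * p * commr f2 f4 + commr f1 f4 * p * commr f2 f3).
Proof.
have := Ideal_mull p (commutator_swap f1 f2 f3 f4).
move/Ideal_add/(_ (commutator_move f1 f3 p (commr f2 f4))).
move/Ideal_add/(_ (commutator_move f1 f4 p (commr f2 f3))).
by rewrite mulrDr !mulrA -addrA [X in _ + X]addrACA -opprD addrC subrK.
Qed.


Lemma commutator_swap_cross f1 f2 f3 f4 p :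
  comm3_ideal (commr f3 f1 * p * commr f2 f4 + commr f4 f1 * p * commr f2 f3).
Proof.
rewrite -(opp_bracket f1 f3) -(opp_bracket f1 f4) 4!mulNr -opprD.
exact/comm3_idealN/commutator_swap_mid.
Qed.

Lemma comm3_ideal_right f g h : comm3_ideal (commr f (commr g h)).
Proof. by rewrite -opp_bracket; apply/comm3_idealN/comm3_ideal_commr. Qed.

Hypothesis unit2 : exists c : A, c * 2%:R = 1.

(** For f3 = f4 the two terms of the previous sum are equal; this is where the
    characteristic matters. *)
Lemma commutator_repeat f1 f2 f3 p :
  comm3_ideal (commr f1 f3 * p * commr f2 f3).
Proof.
have [c c2] := unit2; have := commutator_swap_mid f1 f2 f3 f3 p.
move/(Ideal_mull c); rewrite -mulr2n -mulr_natl mulrA c2 mul1r.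
exact.
Qed.

Lemma commutator_repeat_cross f1 f2 f3 p :
  comm3_ideal (commr f3 f1 * p * commr f2 f3).
Proof.
by rewrite -(opp_bracket f1) 2!mulNr; apply/comm3_idealN/commutator_repeat.
Qed.

Lemma commutator_repeat_left f1 f2 f3 :
  comm3_ideal (commr f3 f1 * commr f3 f2).
Proof.
rewrite -(opp_bracket f1) -(opp_bracket f2) mulrNN.
by rewrite -[commr f1 f3]mulr1; apply: commutator_repeat.
Qed.

End Commutators.

Section WordAlgebra.

Variables (K : fieldType) (N : option nat).
Implicit Types (f g h : free_algebra K N) (u v w : word N) (a b c : K).

Lemma mul_monom a b u v :
  << a *g u >> * << b *g v >> = << a * b *g mmul u v >> :> free_algebra K N.
Proof. by rewrite malgM_def fgmulUU. Qed.

Lemma mul5_monom a0 a1 a2 a3 a4 u0 u1 u2 u3 u4 :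
  << a0 *g u0 >> * << a1 *g u1 >> * << a2 *g u2 >> * << a3 *g u3 >>
    * << a4 *g u4 >> =
  << a0 * a1 * a2 * a3 * a4 *g
     mmul (mmul (mmul (mmul u0 u1) u2) u3) u4 >> :> free_algebra K N.
Proof. by do 4!rewrite mul_monom. Qed.

Lemma malg_ind (P : free_algebra K N -> Prop) :
  P 0 -> (forall f g, P f -> P g -> P (f + g)) ->
    (forall c u, P << c *g u >>) ->
  forall f, P f.
Proof. by move=> P0 PD PU f; rewrite [f]monalgE; apply: big_ind. Qed.

Lemma comm3_ideal_additive (L : {additive free_algebra K N -> K}) :
  (forall a0 a1 a2 a3 a4 u0 u1 u2 u3 u4,
     L (<< a0 *g u0 >> *
        commr (commr << a1 *g u1 >> << a2 *g u2 >>) << a3 *g u3 >> *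
        << a4 *g u4 >>) = 0) ->
  forall f, tideal_comm3 f -> L f = 0.
Proof.
move=> L_leaf f If.
have add00 (a b : K) : a = 0 -> b = 0 -> a + b = 0.
  by move=> -> ->; apply: addr0.
have L0m y z : L (y * 0 * z) = 0 by rewrite mulr0 mul0r raddf0.
have LDl y y' g z : L ((y + y') * g * z) = L (y * g * z) + L (y' * g * z).
  by rewrite -raddfD -2!mulrDl.
have LDr y g z z' : L (y * g * (z + z')) = L (y * g * z) + L (y * g * z').
  by rewrite -raddfD -mulrDr.
have LDm y g g' z : L (y * (g + g') * z) = L (y * g * z) + L (y * g' * z).
  by rewrite -raddfD -mulrDl -mulrDr.
suff: forall y z, L (y * f * z) = 0 by move/(_ 1 1); rewrite mul1r mulr1.
elim: If => {f} [_ [f1 [f2 [f3 ->]]]||f g _ IHf _ IHg|h f _ IHf|f h _ IHf] y z.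
- move: y; apply: malg_ind => [|y y' IHy IHy'|a0 u0].
  + by rewrite !mul0r raddf0.
  + rewrite LDl; exact: (add00 _ _ IHy IHy').
  move: z; apply: malg_ind => [|z z' IHz IHz'|a4 u4].
  + by rewrite mulr0 raddf0.
  + rewrite LDr; exact: (add00 _ _ IHz IHz').
  move: f1; apply: malg_ind => [|f1 f1' IH IH'|a1 u1].
  + by rewrite !bracket0l L0m.
  + rewrite (bracketDl f1 f1') bracketDl LDm; exact: (add00 _ _ IH IH').
  move: f2; apply: malg_ind => [|f2 f2' IH IH'|a2 u2].
  + by rewrite bracket0r !bracket0l L0m.
  + rewrite (bracketDr _ f2 f2') bracketDl LDm; exact: (add00 _ _ IH IH').
  move: f3; apply: malg_ind => [|f3 f3' IH IH'|a3 u3].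
  + by rewrite bracket0r L0m.
  + rewrite (bracketDr _ f3 f3') LDm; exact: (add00 _ _ IH IH').
  exact: L_leaf.
- exact: L0m.
- rewrite LDm; exact: (add00 _ _ (IHf _ _) (IHg _ _)).
- by rewrite mulrA IHf.
- by rewrite mulrA -mulrA IHf.
Qed.

Definition word_functional (chi : seq (letter N) ->
  K) : free_algebra K N -> K :=
  mmap idfun (chi \o @fmonom_val (letter N)).

(** By linearity in each argument it is enough to test a functional on the
  triple
    commutators of words multiplied by words on both sides, and these are
    combinations of four words. *)
Lemma comm3_ideal_vanish (chi : seq (letter N) -> K) :
  (forall p f g h q : seq (letter N),
     chi (p ++ f ++ g ++ h ++ q) - chi (p ++ g ++ f ++ h ++ q)
       - chi (p ++ h ++ f ++ g ++ q) + chi (p ++ h ++ g ++ f ++ q) = 0) ->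
  forall f, tideal_comm3 f -> word_functional chi f = 0.
Proof.
move=> chi0; apply: comm3_ideal_additive => a0 a1 a2 a3 a4 u0 u1 u2 u3 u4.
rewrite comm3_expand -[LHS]/(word_functional chi _);
  set L := word_functional chi.
have L4 x y z t : L (x - y - z + t) = L x - L y - L z + L t.
  by rewrite /L /word_functional mmapD !mmapB.
have L5 b0 b1 b2 b3 b4 v0 v1 v2 v3 v4 :
    L (<< b0 *g v0 >> * << b1 *g v1 >> * << b2 *g v2 >> * << b3 *g v3 >> *
       << b4 *g v4 >>) =
    b0 * b1 * b2 * b3 * b4 * chi (v0 ++ v1 ++ v2 ++ v3 ++ v4).
  rewrite mul5_monom /L /word_functional mmapU; congr (_ * chi _).
  by rewrite 4!fmM -!catA.
rewrite L4; apply: etrans (congr2 +%R (congr2 (fun a b => a - b)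
  (congr2 (fun a b => a - b) (L5 _ _ _ _ _ _ _ _ _ _) (L5 _ _ _ _ _ _ _ _ _ _))
  (L5 _ _ _ _ _ _ _ _ _ _)) (L5 _ _ _ _ _ _ _ _ _ _)) _.
rewrite -[RHS](mulr0 (a0 * a1 * a2 * a3 * a4)) -(chi0 u0 u1 u2 u3 u4).
ring.
Qed.

End WordAlgebra.

(** * Leading words *)

Section LeadingWords.

Variables (K : fieldType) (N : option nat).
Implicit Types (f g h : free_algebra K N) (u v w : word N) (i j k l b c :
  letter N).
Implicit Types (p q s : seq (letter N)).

Lemma deglex_refl u : deglex u u.
Proof. by rewrite /deglex eqxx lexx orbT. Qed.

Lemma deglex_total : total (@deglex N).
Proof. by move=> u v; rewrite /deglex; case: ltngtP => //= _;
  apply: le_total. Qed.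

Lemma deglex_trans : transitive (@deglex N).
Proof.
move=> v u w; rewrite /deglex.
case/orP=> [lt_uv|/andP[/eqP eq_uv le_uv]] /orP[lt_vw|/andP[/eqP eq_vw le_vw]].
- by rewrite (ltn_trans lt_uv).
- by rewrite -eq_vw lt_uv.
- by rewrite eq_uv lt_vw.
by rewrite eq_uv eq_vw eqxx (le_trans le_uv le_vw) orbT.
Qed.

Lemma deglex_anti : antisymmetric (@deglex N).
Proof.
move=> u v; rewrite /deglex; case: ltngtP => //= _ /le_anti eq_uv.
exact: val_inj.
Qed.

Lemma deglex_mone u : deglex (mone : word N) u.
Proof. by rewrite /deglex fm1 /=; case: u => -[]. Qed.

Lemma deglex_maxP (r : seq (word N)) : r != [::] ->
  let m := \big[@deglex_max N/mone]_(w <- r) w in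
  m \in r /\ {in r, forall w, deglex w m}.
Proof.
elim: r => //= u r IHr _; rewrite big_cons.
have [->|/IHr[]] := eqVneq r [::].
  rewrite big_nil /deglex_max; case: ifP => [le_u1|_].
    have -> : u = mone by apply: deglex_anti; rewrite le_u1 deglex_mone.
    by split=> [|w]; rewrite inE // => /eqP->; apply: deglex_refl.
  by split=> [|w]; rewrite inE // => /eqP->; apply: deglex_refl.
set m := \big[_/_]_(w <- r) w => r_m le_m; rewrite /deglex_max.
case: ifP => [le_um|/negbT not_le_um].
  by split=> [|w]; rewrite inE ?r_m ?orbT // => /predU1P[->|/le_m].
have le_mu : deglex m u by case/orP: (deglex_total u m);
  rewrite ?(negPf not_le_um).
split=> [|w]; rewrite inE ?eqxx // => /predU1P[->|/le_m le_wm].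
  exact: deglex_refl.
exact: deglex_trans le_wm le_mu.
Qed.

Lemma lead_word_msupp f : f != 0 ->
  lead_word f \in msupp f /\ {in msupp f, forall w, deglex w (lead_word f)}.
Proof.
move=> f_neq0; have := @deglex_maxP (enum_fset (msupp f)); apply.
by apply: contraNneq f_neq0 => supp0; rewrite -msupp_eq0; apply/eqP/fsetP => w;
  rewrite in_fset0 -[w \in msupp f]/(w \in enum_fset _) supp0.
Qed.

Lemma lead_wordP f v : v \in msupp f -> {in msupp f, forall w, deglex w v} ->
  lead_word f = v.
Proof.
move=> f_v le_v; have [|f_l le_l] := @lead_word_msupp f.
  by apply: contraTneq f_v => ->; rewrite msupp0.
by apply: deglex_anti; rewrite le_v // le_l.
Qed.

Definition slexi p q := ((p : seqlexi (letter N)) < (q : seqlexi (letter N)))%O.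

Lemma slexi_consE i j p q :
  slexi (i :: p) (j :: q) = (i < j)%N || ((i == j :> nat) && slexi p q).
Proof.
rewrite /slexi Order.SeqLexiOrder.ltxi_cons !le_letterE.
by case: ltngtP.
Qed.

Lemma slexi_cat p q s : slexi (s ++ p) (s ++ q) = slexi p q.
Proof. by elim: s => //= i s IHs; rewrite slexi_consE ltnn eqxx. Qed.

Definition mon (s : seq (letter N)) : free_algebra K N := << FMonom s >>.

Lemma monM p q : mon p * mon q = mon (p ++ q).
Proof.
rewrite /mon mul_monom mulr1; congr << _ >>; apply: val_inj => /=.
exact: fmM.
Qed.

Lemma mon1 : mon [::] = 1.
Proof. by rewrite /mon -[FMonom [::]]/(_ [::]) -fmoneE. Qed.

Lemma varE i : var K i = mon [:: i].
Proof. by rewrite /var /mon fmuE. Qed.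

(** The basis polynomials are homogeneous: only words of the same length have to
    be compared, and for these the order is the lexicographic one. *)
Definition lower s f :=
  {in msupp f, forall w, (size w == size s) && slexi w s}.

Lemma lowerD s f g : lower s f -> lower s g -> lower s (f + g).
Proof.
move=> low_f low_g w /(fsubsetP (msuppD_le f g)); rewrite in_fsetU => /orP[].
  exact: low_f.
exact: low_g.
Qed.

Lemma lowerN s f : lower s f -> lower s (- f).
Proof. by move=> low_f w; rewrite msuppN; apply: low_f. Qed.

Lemma lowerB s f g : lower s f -> lower s g -> lower s (f - g).
Proof. by move=> low_f low_g; apply/lowerD/lowerN. Qed.

Lemma lower_mon s p : size p = size s -> slexi p s -> lower s (mon p).
Proof.
move=> size_p lt_ps w; rewrite msuppU1 in_fset1 => /eqP->.
by rewrite /= size_p eqxx.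
Qed.

Lemma lead_word_lower s f : lower s f ->
  lead_word (mon s + f) = FMonom s /\ mon s + f != 0.
Proof.
move=> low_f.
have f_s : f@_(FMonom s) = 0.
  by apply: mcoeff_outdom; apply/negP => /low_f /=; rewrite /slexi ltxx andbF.
have supp_s : FMonom s \in msupp (mon s + f).
  by rewrite -mcoeff_neq0 mcoeffD f_s mcoeffUU addr0 oner_neq0.
split; last by apply: contraTneq supp_s => ->; rewrite msupp0.
apply: lead_wordP => // w /(fsubsetP (msuppD_le _ _)).
rewrite in_fsetU msuppU1 in_fset1 => /orP[/eqP->|/low_f];
  first exact: deglex_refl.
by rewrite /deglex => /andP[-> /ltW->]; rewrite orbT.
Qed.

(** Each basis polynomial is given by its leading word,
  which is cubic_word i b c
    or pair_word j b p i c: cubic_poly covers f', f'', g' and g'', and pair_poly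
    covers t, u' and u'' when j = i. When j < i it is v' if c = b, v'' if c = j,
    w' if c < b and w'' if b < c < j. *)
Definition cubic_poly i b c : free_algebra K N :=
  if (c < b)%N then commr (var K i) (commr (var K b) (var K c))
  else commr (commr (var K i) (var K b)) (var K c).

Definition comm_pair j b p i c : free_algebra K N :=
  commr (var K j) (var K b) * mon p * commr (var K i) (var K c).

Definition pair_poly j b p i c : free_algebra K N :=
  if [|| j == i, c == b | c == j] then comm_pair j b p i c
  else if (c < b)%N then comm_pair j b p i c + comm_pair j c p i b
  else comm_pair j b p i c + comm_pair c b p i j.

Definition cubic_word i b c := [:: i; b; c].
Definition pair_word j b p i c := j :: b :: p ++ [:: i; c].

Definition cubic_cond i b c := (c < i)%N && (b <= i)%N.
Definition pair_cond j b p i c := [/\ (b < j <= i)%N, (c < i)%N && (c <= j)%N,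
  sorted leq (map val p) & all (fun m : letter N => j <= m < i)%N p].

Lemma comm_pair_expand (A : nzRingType) (x y z t p : A) :
  commr x y * p * commr z t =
  x * y * p * z * t + (y * x * p * t * z - y * x * p * z * t - x * y * p * t *
    z).
Proof.
rewrite /commr !(mulrBl, mulrBr) !mulrA opprB -[LHS]addrA; congr (_ + _).
by rewrite addrCA addrA.
Qed.

Lemma comm_pairE j b p i c : comm_pair j b p i c =
  mon (pair_word j b p i c) +
  (mon (pair_word b j p c i) - mon (pair_word b j p i c)
    - mon (pair_word j b p c i)).
Proof.
have mon5 k l k' l' : var K k * var K l * mon p * var K k' * var K l' =
    mon (pair_word k l p k' l').
  by rewrite !varE !monM -!catA.
rewrite /comm_pair comm_pair_expand; exact: (congr2 +%R (mon5 _ _ _ _)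
 (congr2 (fun f g => f - g) (congr2 (fun f g => f - g) (mon5 _ _ _ _)
 (mon5 _ _ _ _)) (mon5 _ _ _ _))).
Qed.

Lemma commr_rightE (A : nzRingType) (x y z : A) :
  commr x (commr y z) = x * y * z + (z * y * x - x * z * y - y * z * x).
Proof.
rewrite /commr mulrBr mulrBl !mulrA opprB -[LHS]addrA; congr (_ + _).
by rewrite addrCA addrA.
Qed.

Lemma commr_leftE (A : nzRingType) (x y z : A) :
  commr (commr x y) z = x * y * z + (z * y * x - y * x * z - z * x * y).
Proof.
rewrite /commr mulrBr mulrBl !mulrA opprB -[LHS]addrA; congr (_ + _).
by rewrite addrCA addrA.
Qed.

Lemma var3 i j k : var K i * var K j * var K k = mon [:: i; j; k].
Proof. by rewrite !varE !monM. Qed.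

Lemma cubic_polyE i b c : cubic_poly i b c =
  mon [:: i; b; c] + (mon [:: c; b; i] -
    mon (if (c < b)%N then [:: i; c; b] else [:: b; i; c]) -
    mon (if (c < b)%N then [:: b; c; i] else [:: c; i; b])).
Proof.
rewrite /cubic_poly; case: ifP => _; first rewrite commr_rightE;
  last rewrite commr_leftE;
  exact: (congr2 +%R (var3 _ _ _) (congr2 (fun f g => f - g)
  (congr2 (fun f g => f - g) (var3 _ _ _) (var3 _ _ _)) (var3 _ _ _))).
Qed.

Lemma lead_cubic i b c : cubic_cond i b c ->
  lead_word (cubic_poly i b c) = FMonom (cubic_word i b c)
  /\ cubic_poly i b c != 0.
Proof.
case/andP=> lt_ci le_bi; rewrite cubic_polyE; apply: lead_word_lower.
by case: ifP => lt_cb; apply: lowerB; [apply: lowerB| |apply: lowerB|];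
  apply: lower_mon; rewrite // !slexi_consE; lia.
Qed.

Lemma lower_pair j b p i c s : (b < j)%N -> (c < i)%N ->
  size (pair_word j b p i c) = size s -> slexi (pair_word j b p i c) s ->
  lower s (comm_pair j b p i c).
Proof.
move=> lt_bj lt_ci size_s lt_s; rewrite comm_pairE.
have low q : size q = size (pair_word j b p i c) ->
    slexi q (pair_word j b p i c) -> lower s (mon q).
  move=> size_q lt_q; apply: lower_mon; first by rewrite size_q.
  exact: lt_trans lt_q lt_s.
apply: lowerD; first exact: lower_mon.
by apply: lowerB; [apply: lowerB|]; apply: low; rewrite /= ?size_cat //
  !slexi_consE ?slexi_cat ?slexi_consE; lia.
Qed.

Lemma lead_comm_pair j b p i c f : (b < j)%N -> (c < i)%N ->
  lower (pair_word j b p i c) f ->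
  lead_word (comm_pair j b p i c + f) = FMonom (pair_word j b p i c)
  /\ comm_pair j b p i c + f != 0.
Proof.
move=> lt_bj lt_ci low_f; rewrite comm_pairE -addrA; apply: lead_word_lower.
apply: lowerD => //.
by apply: lowerB; [apply: lowerB|]; apply: lower_mon; rewrite /= ?size_cat //
  !slexi_consE ?slexi_cat ?slexi_consE; lia.
Qed.

Lemma lead_pair j b p i c : pair_cond j b p i c ->
  lead_word (pair_poly j b p i c) = FMonom (pair_word j b p i c)
  /\ pair_poly j b p i c != 0.
Proof.
case=> /andP[lt_bj le_ji] /andP[lt_ci le_cj] _ _; rewrite /pair_poly.
have [_|/norP[neq_ji /norP[neq_cb neq_cj]]] := boolP [|| _, _ | _].
  rewrite -[comm_pair _ _ _ _ _]addr0; apply: lead_comm_pair => // w.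
  by rewrite msupp0 in_fset0.
move: neq_ji neq_cb neq_cj;
  rewrite -!(inj_eq val_inj) /= => neq_ji neq_cb neq_cj.
case: ifP => lt_cb; apply: lead_comm_pair => //; apply: lower_pair;
  rewrite /= ?size_cat // ?slexi_consE ?slexi_cat ?slexi_consE; lia.
Qed.

End LeadingWords.

(** * The basis indexed by leading words *)

Section Reindexing.

Variables (K : fieldType) (N : option nat).
Implicit Types (i j k l b c m : letter N) (a : letter N -> nat).
Implicit Types (p q r s : seq (letter N)).

Definition power_word r a := flatten [seq nseq (a m) m | m <- r].

Lemma mon_nseq n m : mon K (nseq n m) = var K m ^+ n.
Proof.
elim: n => [|n IHn]; first exact: mon1.
by rewrite exprS -IHn varE monM.
Qed.

Lemma mon_power_word r a :
  mon K (power_word r a) = \prod_(m <- r) var K m ^+ a m.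
Proof.
elim: r => [|m r IHr]; first by rewrite big_nil mon1.
by rewrite big_cons -IHr -mon_nseq monM.
Qed.

Lemma mem_letters_between j i m : (m \in letters_between j i) = (j <= m < i)%N.
Proof.
by rewrite -(mem_map (val_inj : injective (@letter_idx N))) letters_betweenE
  mem_index_iota.
Qed.

Lemma letters_between_uniq j i : uniq (letters_between j i).
Proof.
by rewrite -(map_inj_uniq (val_inj : injective (@letter_idx N)))
  letters_betweenE
  iota_uniq.
Qed.

Lemma letters_between_sorted j i :
  pairwise (relpre val leq) (letters_between j i).
Proof.
rewrite -sorted_pairwise; last by move=> x y z; apply: leq_trans.
by rewrite -sorted_map letters_betweenE iota_sorted.
Qed.

Lemma count_power_word r a m : uniq r ->
  count_mem m (power_word r a) = ((m \in r) * a m)%N.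
Proof.
elim: r => //= x r IHr /andP[r_x /IHr{}IHr].
rewrite /power_word /= count_cat count_nseq -/(power_word r a) IHr in_cons /=.
by have [<-|_] := eqVneq x m; rewrite ?(negPf r_x) ?mul0n ?addn0.
Qed.

Lemma mem_power_word r a m : m \in power_word r a -> m \in r.
Proof.
by case/flattenP=> _ /mapP[x r_x ->]; rewrite mem_nseq => /andP[_ /eqP->].
Qed.

Lemma power_word_sorted r a : pairwise (relpre val leq) r ->
  sorted leq (map val (power_word r a)).
Proof.
rewrite sorted_map sorted_pairwise => [|x y z]; last exact: leq_trans.
elim: r => //= x r IHr /andP[le_xr /IHr{}IHr].
rewrite /power_word /= pairwise_cat IHr andbT; apply/andP; split.
  apply/allrelP=> y z; rewrite mem_nseq => /andP[_ /eqP->] /mem_power_word.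
  exact: (allP le_xr).
by elim: (a x) => //= n ->; rewrite andbT; apply/allP => y;
  rewrite mem_nseq => /andP[_ /eqP->] /=.
Qed.

Lemma power_prod_word j i a :
  power_prod K j i a = mon K (power_word (letters_between j i) a).
Proof. by rewrite mon_power_word. Qed.

Lemma power_word_between j i a (p := power_word (letters_between j i) a) :
  sorted leq (map val p) /\ all (fun m : letter N => j <= m < i)%N p.
Proof.
split; first exact/power_word_sorted/letters_between_sorted.
by apply/allP=> m /mem_power_word; rewrite mem_letters_between.
Qed.

(** An ascending word in the letters from j to i - 1 is determined by the
    multiplicities of its letters; these are the exponents. *)
Lemma between_power_prod j i p : sorted leq (map val p) ->
  all (fun m : letter N => j <= m < i)%N p ->
  mon K p = power_prod K j i (fun m => count_mem m p).
Proof.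
move=> sort_p /allP le_jpi; rewrite power_prod_word; congr mon.
set q := power_word _ _;
  have [sort_q _] := power_word_between j i (fun m => count_mem m p).
apply: (inj_map val_inj); apply: (sorted_eq leq_trans anti_leq) => //.
apply/perm_map/allP => m _ /=;
  rewrite count_power_word ?letters_between_uniq //.
rewrite mem_letters_between; have [p_m|p_m] := boolP (m \in p).
  by rewrite le_jpi // mul1n.
by rewrite (count_memPn p_m) muln0.
Qed.

Lemma comm_pair_nil j b i c : comm_pair K j b [::] i c =
  commr (var K j) (var K b) * commr (var K i) (var K c).
Proof.
by rewrite /comm_pair mon1; exact: (congr1 (fun f => f * _) (mulr1 _)).
Qed.

Lemma basis_cubic i b c : cubic_cond i b c ->
  grassmann_basis (cubic_poly K i b c).
Proof.
case/andP=> lt_ci le_bi; rewrite /cubic_poly;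
  case: (ltngtP c b) => [lt_cb|lt_bc|/val_inj<-].
- have [lt_bi|ge_bi] := ltnP b i; first by apply: Basis_g'; rewrite lt_cb.
  have -> : b = i by apply: val_inj; apply/eqP; rewrite eqn_leq le_bi.
  exact: Basis_f''.
- by apply: Basis_g''; rewrite lt_bc.
exact: Basis_f'.
Qed.

Lemma basis_pair j b p i c : pair_cond j b p i c ->
  grassmann_basis (pair_poly K j b p i c).
Proof.
case=> /andP[lt_bj le_ji] /andP[lt_ci le_cj] sort_p p_ji;
  rewrite /pair_poly /comm_pair.
have [eq_ji|neq_ji] /= := eqVneq j i.
  have -> : p = [::].
    by case: p {sort_p} p_ji => //= m p /andP[]; rewrite eq_ji; case: leqP.
  rewrite mon1 mulr1 eq_ji; rewrite eq_ji in lt_bj.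
  case: (ltngtP c b) => [lt_cb|lt_bc|/val_inj->]; last exact: Basis_t.
    by apply: Basis_u'; rewrite lt_cb.
  by apply: Basis_u''; rewrite lt_bc.
have lt_ji : (j < i)%N by rewrite ltn_neqAle le_ji andbT.
rewrite (between_power_prod sort_p p_ji); set a := fun _ => _.
have [->|neq_cb] /= := eqVneq c b; first by apply: Basis_v'; rewrite lt_bj.
have [->|neq_cj] /= := eqVneq c j; first by apply: Basis_v''; rewrite lt_bj.
have lt_cj : (c < j)%N by rewrite ltn_neqAle le_cj andbT.
case: ifP => [lt_cb|/negbT]; first by apply: Basis_w'; rewrite ?lt_cb.
rewrite -leqNgt leq_eqVlt eq_sym (inj_eq val_inj) (negPf neq_cb) /= => lt_bc.
by apply: Basis_w''; rewrite ?lt_bc.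
Qed.

Lemma basis_shape g : grassmann_basis g ->
  (exists i b c, cubic_cond i b c /\ g = cubic_poly K i b c) \/
  (exists j b p i c, pair_cond j b p i c /\ g = pair_poly K j b p i c).
Proof.
have neq i j : (j < i)%N -> (j == i) = false.
  by move=> lt_ji; apply: contraTF lt_ji => /eqP->; rewrite ltnn.
case=> {g} [i j lt_ji|i j lt_ji|i j k /andP[lt_kj lt_ji]|i j k /andP[lt_kj
  lt_ji]
  |i j lt_ji|i j k /andP[lt_kj lt_ji]|i j k /andP[lt_kj lt_ji]
  |i j k a /andP[lt_kj lt_ji]|i j k a /andP[lt_kj lt_ji]
  |i j k l a /andP[lt_lk lt_kj] lt_ji|i j k l a /andP[lt_lk lt_kj] lt_ji].
- left; exists i, j, j; split; first by rewrite /cubic_cond; lia.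
  by rewrite /cubic_poly ltnn.
- left; exists i, i, j; split; first by rewrite /cubic_cond; lia.
  by rewrite /cubic_poly lt_ji.
- left; exists i, j, k; split; first by rewrite /cubic_cond; lia.
  by rewrite /cubic_poly lt_kj.
- left; exists i, k, j; split; first by rewrite /cubic_cond; lia.
  by rewrite /cubic_poly ltnNge ltnW.
- right; exists i, j, [::], i, j; split; last first.
    by rewrite /pair_poly eqxx comm_pair_nil.
  by split=> //; lia.
- right; exists i, j, [::], i, k; split; last first.
    by rewrite /pair_poly eqxx comm_pair_nil.
  by split=> //; lia.
- right; exists i, k, [::], i, j; split; last first.
    by rewrite /pair_poly eqxx comm_pair_nil.
  by split=> //; lia.
- have [sort_p p_ji] := power_word_between j i a.
  right; exists j, k, (power_word (letters_between j i) a), i, k; split;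
    last first.
    by rewrite /pair_poly eqxx orbT /comm_pair -power_prod_word.
  by split=> //; lia.
- have [sort_p p_ji] := power_word_between j i a.
  right; exists j, k, (power_word (letters_between j i) a), i, j; split;
    last first.
    by rewrite /pair_poly eqxx !orbT /comm_pair -power_prod_word.
  by split=> //; lia.
- have [sort_p p_ji] := power_word_between j i a.
  right; exists j, k, (power_word (letters_between j i) a), i, l; split;
    last first.
    rewrite /pair_poly (neq _ _ lt_ji) (neq _ _ lt_lk) (neq _ _ (ltn_trans
      lt_lk lt_kj)).
    by rewrite lt_lk /comm_pair -power_prod_word.
  have lt_lj := ltn_trans lt_lk lt_kj.
  by split=> //; lia.
have [sort_p p_ji] := power_word_between j i a.
right; exists j, l, (power_word (letters_between j i) a), i, k; split;
  last first.
  rewrite /pair_poly (neq _ _ lt_ji) (eq_sym k) (neq _ _ lt_lk) (neq _ _ lt_kj).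
  by rewrite ltnNge (ltnW lt_lk) /comm_pair -power_prod_word.
by split=> //; lia.
Qed.

Lemma half2 : 2%N \notin [pchar K] ->
  exists c : free_algebra K N, c * 2%:R = 1.
Proof.
rewrite inE /= => nz2; exists ((2%:R^-1)%:MP).
by rewrite -mpolyC_nat -mpolyCM mulVf.
Qed.

Lemma basis_in_ideal g : 2%N \notin [pchar K] -> grassmann_basis g ->
  @tideal_comm3 K N g.
Proof.
move=> /half2 unit2 basis_g; change (comm3_ideal g).
case: g / basis_g => [i j _|i j _|i j k _|i j k _|i j _|i j k _|i j k _|i j k
  a _
  |i j k a _|i j k l a _ _|i j k l a _ _].
- exact: comm3_ideal_commr.
- exact: comm3_ideal_right.
- exact: comm3_ideal_right.
- exact: comm3_ideal_commr.
- exact: commutator_repeat_left.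
- exact: commutator_repeat_left.
- exact: commutator_repeat_left.
- exact: commutator_repeat.
- exact: commutator_repeat_cross.
- exact: commutator_swap_mid.
exact: commutator_swap_cross.
Qed.

End Reindexing.

(** * Factors of leading words *)

Section Antichain.

Variables (K : fieldType) (N : option nat).
Implicit Types (i j k l b c m x y z u v : letter N).
Implicit Types (p q r s : seq (letter N)).

Definition ascending s := pairwise (relpre (@letter_idx N) leq) s.

Lemma ascendingE s : ascending s = sorted leq (map val s).
Proof.
by rewrite sorted_map sorted_pairwise // => x y z; apply: leq_trans.
Qed.

Lemma ascending_factor p x q y s : ascending (p ++ x :: q ++ y :: s) ->
  (x <= y)%N.
Proof.
rewrite /ascending pairwise_cat pairwise_cons => /and4P[_ _ /allP le_x _].
by apply: le_x; rewrite mem_cat mem_head orbT.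
Qed.

Lemma pair_word_ascending j b p i c : pair_cond j b p i c ->
  ascending (b :: rcons p i).
Proof.
case=> bji _; rewrite -ascendingE /ascending => asc_p /allP p_ji.
rewrite /= pairwise_rcons asc_p andbT all_rcons -andbA; apply/and3P; split.
- by rewrite /=; lia.
- by apply/allP=> m /p_ji /=; lia.
by apply/allP=> m /p_ji /=; lia.
Qed.

Lemma pair_word_rcons j b p i c : pair_word j b p i c =
  j :: rcons (b :: rcons p i) c.
Proof. by rewrite /pair_word -!cats1 /= -catA. Qed.

Lemma cubic_in_cubic x y z i b c :
  infix (cubic_word x y z) (cubic_word i b c) ->
    cubic_word x y z = cubic_word i b c.
Proof.
case/infixP=> p [s eq_w]; have := congr1 size eq_w;
  rewrite !size_cat /= => eq_n.
move/eqP: eq_n; rewrite addnCA -{1}[3%N]addn0 eqn_add2l eq_sym addn_eq0.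
by rewrite eq_w !size_eq0 => /andP[/eqP-> /eqP->].
Qed.

Lemma pair_in_cubic j b p i c x y z :
  ~~ infix (pair_word j b p i c) (cubic_word x y z).
Proof.
by apply/negP => /size_infix; rewrite /= size_cat /= addnC.
Qed.

(** A pair word without its first and its last letter is ascending. Hence a
    factor x y z with z < x either starts at x = j, and then j <= z, or ends at
    z = c, and then x < i = y. *)
Lemma cubic_in_pair x y z j b p i c : cubic_cond x y z -> pair_cond j b p i c ->
  ~~ infix (cubic_word x y z) (pair_word j b p i c).
Proof.
move=> /andP[lt_zx le_yx] W; have asc := pair_word_ascending W.
have [bji cij _ /allP p_ji] := W.
apply/negP => /infixP[r [s]]; rewrite pair_word_rcons.
case: r => [|a r] /= [eq_j].
  move=> eq_b eq_z; have : z \in rcons p i.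
    by case: p {W asc p_ji} eq_z => [|m p] [-> _]; rewrite mem_head.
  rewrite -eq_j in lt_zx; rewrite mem_rcons inE => /orP[/eqP eq_zi|/p_ji];
    last by lia.
  by rewrite eq_zi in lt_zx; lia.
case/lastP: s => [|s c'].
  rewrite -(cat_rcons x) -(cat_rcons y) cats1 -rcons_cons.
  move=> /rcons_inj[]; rewrite -rcons_cons => /rcons_inj[eq_r eq_iy] _.
  have: x \in b :: p by rewrite eq_r mem_rcons mem_head.
  rewrite -eq_iy in le_yx; rewrite inE => /orP[/eqP eq_xb|/p_ji]; last by lia.
  by rewrite eq_xb in le_yx; lia.
rewrite -!rcons_cons -rcons_cat => /rcons_inj[eq_r _]; move: asc; rewrite eq_r.
by move/(@ascending_factor _ x [:: y] z s); lia.
Qed.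

(** The larger pair word without its first and its last letter is ascending,
    while the smaller one starts and ends with a descent. Hence these descents
    are those at the two ends of the larger one. *)
Lemma pair_in_pair x y q u v j b p i c : pair_cond x y q u v ->
  pair_cond j b p i c ->
  infix (pair_word x y q u v) (pair_word j b p i c) ->
  [/\ x = j, y = b, q = p, u = i & v = c].
Proof.
move=> [yxu vux _ _] W; have asc := pair_word_ascending W.
case/infixP=> r [s]; rewrite [pair_word j _ _ _ _]pair_word_rcons /pair_word
  /= -!catA /=.
case: r => [|a r] /= [eq_j].
  move: eq_j => -> ->; case/lastP: s => [|s c'].
    by rewrite -cat_rcons cats1 => /rcons_inj[/rcons_inj[-> ->] ->].
  rewrite -!rcons_cons -rcons_cat => /rcons_inj[eq_p _].
  by move: asc; rewrite eq_p; move/(@ascending_factor (b :: q) u [::] v s); lia.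
have: size (q ++ [:: u, v & s]) != 0%N by rewrite size_cat addnC.
case/lastP: (q ++ _) => [//|t c'] _.
rewrite -!rcons_cons -rcons_cat => /rcons_inj[eq_p _].
by move: asc; rewrite eq_p; move/(@ascending_factor r x [::] y t); lia.
Qed.

(** * Normal words as the words without leading factors *)

Definition lead_shape w :=
  (exists i b c, cubic_cond i b c /\ w = cubic_word i b c) \/
  (exists j b p i c, pair_cond j b p i c /\ w = pair_word j b p i c).

Definition has_lead w := exists2 s, lead_shape s & infix s w.

Lemma has_lead_infix s w : infix s w -> has_lead s -> has_lead w.
Proof. by move=> sw [t t_lead ts]; exists t => //; apply: infix_trans sw. Qed.

Lemma cubic_or_lead i b c w p q : w = p ++ [:: i, b, c & q] -> (b <= i)%N ->
  (i <= c)%N \/ has_lead w.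
Proof.
move=> -> le_bi; case: leqP => [|lt_ci]; [by left | right].
exists (cubic_word i b c); first by left; exists i, b, c;
  rewrite /cubic_cond lt_ci.
by apply/infixP; exists p, q.
Qed.

Definition starts_above m (w : seq (letter N)) :=
  if w is i :: _ then (m <= i)%N else true.

Lemma ascending_last j p m : ascending (j :: p) -> m \in p ->
  (j <= m <= last j p)%N.
Proof.
move=> asc p_m; have /andP[/allP/(_ m p_m) /= -> _] := asc.
move: asc; rewrite /ascending lastI pairwise_rcons => /andP[/allP le_last _].
have: m \in rcons (belast j p) (last j p) by rewrite -lastI inE p_m orbT.
by rewrite mem_rcons inE => /predU1P[->|/le_last] /=; rewrite ?leqnn.
Qed.

Lemma ascending_head_last j p : ascending (j :: p) -> (j <= last j p)%N.
Proof.
case: p => [|k p] asc; first exact: leqnn.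
by have /andP[] := ascending_last asc (mem_last k p).
Qed.

Lemma ascending_rcons j p i : ascending (j :: p) -> (last j p <= i)%N ->
  ascending (j :: rcons p i).
Proof.
move=> asc le_pi; rewrite -rcons_cons /ascending pairwise_rcons -/(ascending _).
rewrite asc andbT; apply/allP => m; rewrite inE => /predU1P[->|p_m] /=.
  exact: leq_trans (ascending_head_last asc) le_pi.
by apply: leq_trans le_pi; case/andP: (ascending_last asc p_m).
Qed.

(** The induction keeps the last pair j b and the ascending part p read since
    then: if a descent i b' comes next, then b' <= j would complete the factor
    pair_word j b p i b'. For b' > j the pair (i,
      b') is recorded and the reading
    starts again after it. *)
Lemma normal_after_pair j b p w : (b < j)%N -> ascending (j :: p) ->
  starts_above (last j p) w ->
  (exists ps, normal (last j p).+1 j.+1 w ps) \/ has_lead (j :: b :: p ++ w).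
Proof.
have [n] := ubnP (size w); elim: n => // n IHn in w j b p *.
case: w => [|i [|b' w]] /=.
- by move=> _ _ _ _; left; exists [::]; constructor.
- move=> _ _ _ le_pi; left; exists [::].
  by apply: Normal_up => //; constructor.
rewrite ltnS => size_w lt_bj asc le_pi.
have le_ji : (j <= i)%N := leq_trans (ascending_head_last asc) le_pi.
case: (ltnP b' i) => [lt_b'i|le_ib']; last first.
  have := IHn (b' :: w) j b (rcons p i) size_w lt_bj (ascending_rcons asc
    le_pi).
  rewrite last_rcons cat_rcons => /(_ le_ib')[[ps w_ps]|]; last by right.
  by left; exists ps; apply: Normal_up.
have [lt_pi|ge_pi] := ltnP (last j p) i; last first.
  have eq_pi : last j p = i by apply/val_inj/eqP; rewrite eqn_leq le_pi.
  case/lastP: p asc le_pi ge_pi eq_pi => [|p k] asc _ _.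
    move=> /= eq_ji; rewrite -eq_ji in lt_b'i *; right;
      exists (pair_word j b [::] j b').
      by right; exists j, b, [::], j, b'; split=> //; split=> //; lia.
    by apply/infixP; exists [::], w.
  rewrite last_rcons => ->.
  have eq_w : j :: b :: rcons p i ++ [:: i, b' & w] =
      (j :: b :: p) ++ [:: i, i, b' & w] by rewrite /= cat_rcons.
  case: (cubic_or_lead eq_w (leqnn i)); last by right.
  by rewrite leqNgt lt_b'i.
(* At a second copy of the last letter a descent would give a factor i i b',
   or the pair word with j = i and p empty; so from now on i is new. *)
have [lt_jb'|le_b'j] := ltnP j b'; last first.
  right; exists (pair_word j b p i b'); last first.
    by apply/infixP; exists [::], w; rewrite /pair_word /= -catA.
  right; exists j, b, p, i, b'; split=> //; split; [lia | lia | |].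
    by rewrite -ascendingE; case/andP: asc.
  by apply/allP=> m /(ascending_last asc); lia.
have starts_w : starts_above i w \/ has_lead (j :: b :: p ++ [:: i, b' & w]).
  case: w {size_w} => [|k w]; first by left.
  by apply: (@cubic_or_lead i b' k _ (j :: b :: p) w) => //; apply: ltnW.
case: starts_w => [starts_w|]; last by right.
have [||||[ps w_ps]|lead] := IHn w i b' [::] => //; first exact: ltnW.
- by left; exists ((i, b') :: ps); apply: Normal_down => //; rewrite lt_jb'.
right; apply: has_lead_infix lead; apply/infixP.
by exists (j :: b :: p), [::]; rewrite cats0.
Qed.

(** Before the first pair only the last letter l matters: it excludes the
    descents that start at a second copy of l. *)
Lemma normal_after_letter l w : starts_above l w ->
  (exists ps, normal l.+1 0 w ps) \/ has_lead (l :: w).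
Proof.
elim: w l => [|i w IHw] l /=; first by left; exists [::]; constructor.
move=> le_li; have infix_w : infix (i :: w) [:: l, i & w].
  by apply/infixP; exists [:: l], [::]; rewrite cats0.
have [starts_w|] := boolP (starts_above i w).
  case: (IHw i starts_w) => [[ps w_ps]|lead]; last by right;
    apply: has_lead_infix lead.
  by left; exists ps; apply: Normal_up.
case: w {IHw} infix_w => //= b w infix_w; rewrite -ltnNge => lt_bi.
have [lt_li|ge_li] := ltnP l i; last first.
  case: (@cubic_or_lead l i b [:: l, i, b & w] [::] w erefl ge_li);
    last by right.
  by rewrite leqNgt (leq_trans lt_bi ge_li).
have starts_w : starts_above i w \/ has_lead [:: i, b & w].
  case: w {infix_w} => [|k w]; first by left.
  by apply: (@cubic_or_lead i b k _ [::] w) => //; apply: ltnW.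
case: starts_w => [starts_w|lead]; last by right; apply: has_lead_infix lead.
case: (@normal_after_pair i b [::] w lt_bi isT starts_w) => [[ps w_ps]|lead].
  by left; exists ((i, b) :: ps); apply: Normal_down.
by right; apply: has_lead_infix lead.
Qed.

Lemma normal_or_lead w : (exists ps, normal 0 0 w ps) \/ has_lead w.
Proof.
case: w => [|i w]; first by left; exists [::]; constructor.
have [starts_w|] := boolP (starts_above i w).
  case: (normal_after_letter starts_w) => [[ps w_ps]|]; last by right.
  by left; exists ps; apply: Normal_up.
case: w => //= b w; rewrite -ltnNge => lt_bi.
have starts_w : starts_above i w \/ has_lead [:: i, b & w].
  case: w => [|k w]; first by left.
  by apply: (@cubic_or_lead i b k _ [::] w) => //; apply: ltnW.
case: starts_w => [starts_w|]; last by right.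
case: (@normal_after_pair i b [::] w lt_bi isT starts_w) => [[ps w_ps]|].
  by left; exists ((i, b) :: ps); apply: Normal_down.
by right.
Qed.

(** * The Groebner basis *)

Lemma basis_lead g : grassmann_basis g ->
  exists2 s, lead_shape s &
    lead_word g = FMonom s /\ g != 0 :> free_algebra K N.
Proof.
case/basis_shape=> [[i [b [c [W ->]]]]|[j [b [p [i [c [W ->]]]]]]].
  by exists (cubic_word i b c); [left; exists i, b, c | apply: lead_cubic].
exists (pair_word j b p i c); last exact: lead_pair.
by right; exists j, b, p, i, c.
Qed.

Lemma lead_basis s : lead_shape s ->
  exists2 g, grassmann_basis g &
    lead_word g = FMonom s /\ g != 0 :> free_algebra K N.
Proof.
case=> [[i [b [c [W ->]]]]|[j [b [p [i [c [W ->]]]]]]].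
  by exists (cubic_poly K i b c); [apply: basis_cubic | apply: lead_cubic].
by exists (pair_poly K j b p i c); [apply: basis_pair | apply: lead_pair].
Qed.

Lemma basis_antichain (g h : free_algebra K N) :
  grassmann_basis g -> grassmann_basis h -> infix (lead_word h) (lead_word g) ->
  h = g.
Proof.
have lead_c f x y z : cubic_cond x y z -> f = cubic_poly K x y z ->
    lead_word f = FMonom (cubic_word x y z).
  by move=> W ->; case: (lead_cubic K W).
have lead_p f x y q u v : pair_cond x y q u v -> f = pair_poly K x y q u v ->
    lead_word f = FMonom (pair_word x y q u v).
  by move=> W ->; case: (lead_pair K W).
case/basis_shape=> [[i [b [c [W eq_g]]]]|[j [b [p [i [c [W eq_g]]]]]]];
  case/basis_shape=> [[x [y [z [W' eq_h]]]]|[x [y [q [u [v [W' eq_h]]]]]]].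
- rewrite (lead_c _ _ _ _ W eq_g) (lead_c _ _ _ _ W' eq_h) => /cubic_in_cubic.
  case=> eq_x eq_y eq_z; rewrite eq_h eq_g eq_x eq_y eq_z; reflexivity.
- rewrite (lead_c _ _ _ _ W eq_g) (lead_p _ _ _ _ _ _ W' eq_h) => sub.
  by have := pair_in_cubic x y q u v i b c; rewrite sub.
- rewrite (lead_p _ _ _ _ _ _ W eq_g) (lead_c _ _ _ _ W' eq_h) => sub.
  by have := cubic_in_pair W' W; rewrite sub.
rewrite (lead_p _ _ _ _ _ _ W eq_g) (lead_p _ _ _ _ _ _ W' eq_h) => sub.
have [eq_x eq_y eq_q eq_u eq_v] := pair_in_pair W' W sub.
rewrite eq_h eq_g eq_x eq_y eq_q eq_u eq_v; reflexivity.
Qed.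

(** The functional chi vanishes on the ideal and at the words smaller than
    v = lead_word f, and takes the value 1 at v; its value at f is the leading
    coefficient of f. *)
Lemma ideal_lead_not_normal (f : free_algebra K N) ps :
  tideal_comm3 f -> f != 0 -> ~ normal 0 0 (lead_word f) ps.
Proof.
move=> If nz_f v_ps; have [supp_v le_v] := lead_word_msupp nz_f.
set v := lead_word f in v_ps supp_v le_v.
have uniq_ps := normal_uniq v_ps.
pose m := grassmann_modelP K uniq_ps.
have supp_m : supported (gm_e m) 0 ps by move=> i _; apply: gm_out.
pose chi (u : seq (letter N)) :=
  if perm_eq u v then top_coef m (inv_prod (gm_e m) u) else 0.
have chi_v : chi v = 1.
  rewrite /chi perm_refl (inv_prod_normal v_ps supp_m).
  exact: top_coef_pairs.
have chi_u (u : word N) : u \in msupp f -> u != v -> chi u = 0.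
  move=> /le_v le_uv neq_uv; rewrite /chi; case: ifP => // uv.
  have lexi_uv : lexi u v.
    by move: le_uv; rewrite /deglex (perm_size uv) ltnn eqxx.
  have [b ps_b avoid_b] := normal_max v_ps uv lexi_uv neq_uv.
  apply: (top_coef_free ps_b); apply: avoid_b => // i j ib jb.
  exact: even_comm_annihilator.
have perm_v (s t : seq (letter N)) : perm_eq s t -> perm_eq s v = perm_eq t v.
  by move/permPl->.
have : word_functional chi f = 0.
  apply: comm3_ideal_vanish If => p f1 f2 f3 q; rewrite /chi.
  (* The four words are rearrangements of one another. *)
  have e1 : perm_eq (p ++ f2 ++ f1 ++ f3 ++ q) v =
      perm_eq (p ++ f1 ++ f2 ++ f3 ++ q) v.
    by apply: perm_v; rewrite perm_cat2l perm_catCA.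
  have e2 : perm_eq (p ++ f3 ++ f1 ++ f2 ++ q) v =
      perm_eq (p ++ f1 ++ f2 ++ f3 ++ q) v.
    by apply: perm_v; rewrite perm_cat2l (catA f1 f2 q) perm_catCA -catA.
  have e3 : perm_eq (p ++ f3 ++ f2 ++ f1 ++ q) v =
      perm_eq (p ++ f1 ++ f2 ++ f3 ++ q) v.
    by rewrite -e2; apply: perm_v; rewrite 2!perm_cat2l perm_catCA.
  rewrite e1 e2 e3; case: ifP => _; last by rewrite !subr0 addr0.
  rewrite -!top_coefB -top_coefD inv_prod_comm3; first exact: mxE.
    exact: gm_anti.
  exact: gm_sq.
rewrite /word_functional mmapE (big_fsetD1 v) //= big1_fset ?addr0.
  move=> eq0; move: supp_v; rewrite -mcoeff_neq0; apply/negP; rewrite negbK.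
  by rewrite -[f@_v]mulr1 -chi_v; apply/eqP.
by move=> u; rewrite in_fsetD1 => /andP[neq_uv supp_u] _;
  rewrite /= chi_u // mulr0.
Qed.

End Antichain.

Theorem theorem4p2 (K : fieldType) (N : option nat)
    (charK : 2%N \notin [pchar K]%R)
    (card_X : if N is Some n then (1 < n)%N else true) :
  is_minimal_groebner_basis (@tideal_comm3 K N) (@grassmann_basis K N).
Proof.
have in_ideal g : grassmann_basis g -> @tideal_comm3 K N g.
  exact: basis_in_ideal.
split.
  split=> // f If nz_f.
  have [[ps normal_f]|[s shape_s s_f]] := normal_or_lead (lead_word f).
    by case: (ideal_lead_not_normal If nz_f normal_f).
  have [g basis_g [lead_g nz_g]] := lead_basis K shape_s.
  by exists g; rewrite lead_g.
move=> g basis_g [_ gb]; have [_ _ [_ nz_g]] := basis_lead basis_g.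
have [h [[basis_h neq_hg] _ sub]] := gb g (in_ideal _ basis_g) nz_g.
exact/neq_hg/basis_antichain.
Qed.
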